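(* Let $X_\Delta$ be an $n$-dimensional smooth complete toric variety over $\mathbb{C}$ with fan $\Delta$ and torus $T$. In the ring $\mathbb{Z}[M][q]$, one has $$\sum_{k=0}^{n}q^k\,\operatorname{char}_T H^0\Big(X_\Delta,\bigwedge\nolimits^kT_{X_\Delta}\Big)=\sum_{u\in P_\Delta\cap M}\mathbf{e}^{-u}q^{i(u)}(1+q)^{n-i(u)}.$$
   Context: Let $N\cong\mathbb{Z}^n$ be a lattice, $M=\operatorname{Hom}(N,\mathbb{Z})$ its dual, $\langle-,-\rangle$ the natural pairing (extended linearly), $N_{\mathbb{R}}=N\otimes\mathbb{R}$, $N_{\mathbb{C}}=N\otimes\mathbb{C}$, $M_{\mathbb{R}}=M\otimes\mathbb{R}$. $\Delta$ is a smooth complete fan in $N_{\mathbb{R}}$, $\Delta(1)$ is its set of rays, and $v_\rho\in N$ is the primitive generator of $\rho\in\Delta(1)$. $X_\Delta$ is the associated toric variety with dense torus $T=N\otimes_{\mathbb{Z}}\mathbb{C}^*$; for $m\in M$, $\chi^m:T\to\mathbb{C}^*$ is the corresponding character. Global sections are algebraic, equivalently holomorphic by GAGA; $\bigwedge^0T_{X_\Delta}=\mathcal{O}_{X_\Delta}$. $P_\Delta=\{u\in M_{\mathbb{R}}\mid\langle u,v_\rho\rangle\ge-1\text{ for every }\rho\in\Delta(1)\}$. For $u\in P_\Delta$, $i(u)=\dim_{\mathbb{C}}L_u$, where $L_u=\operatorname{Span}_{\mathbb{C}}\{v_\rho\mid\rho\in\Delta(1),\ \langle u,v_\rho\rangle=-1\}\subseteq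 N_{\mathbb{C}}$. $T$ acts on $H^0(X_\Delta,\bigwedge^kT_{X_\Delta})$ by $(t\cdot s)(p)=t_*(s(t^{-1}p))$. $\mathbb{Z}[M]$ is the integral group ring of $M$, with basis $\mathbf{e}^m$ ($m\in M$) and multiplication $\mathbf{e}^m\mathbf{e}^{m'}=\mathbf{e}^{m+m'}$. For a finite-dimensional rational representation $V$ of $T$ with weight spaces $V_m=\{v\in V\mid t\cdot v=\chi^m(t)v\text{ for every }t\in T\}$, its formal $T$-character is $\operatorname{char}_T(V)=\sum_{m\in M}(\dim_{\mathbb{C}}V_m)\mathbf{e}^m\in\mathbb{Z}[M]$. *)

(* Defs.v *)
From HB Require Import structures.
From mathcomp Require Import all_boot all_order all_algebra.
From mathcomp Require Import finmap.
From mathcomp Require Import generic_quotient ring_quotient.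
From mathcomp Require Import all_classical all_reals.
From mathcomp Require Import complex.
From mathcomp Require Import ring.

Set Implicit Arguments.
Unset Strict Implicit.
Unset Printing Implicit Defensive.

Import Order.TTheory GRing.Theory Num.Theory.
Local Open Scope classical_set_scope.
Local Open Scope quotient_scope.
Local Open Scope ring_scope.

(* The free K-module on S. The malg type of multinomials is not used: its
   product requires a monoid without nontrivial units, hence excludes groups. *)
Section FreeModule.
Variables (K : comNzRingType) (S : choiceType).

Record fmod : Type := FMod { fmod_val : {fsfun S -> K with 0} }.
HB.instance Definition _ := [isNew for fmod_val].
HB.instance Definition _ := [Choice of fmod by <:].

Implicit Types (f g : fmod) (s : S) (c : K).

Definition fcoef f s : K := fmod_val f s.
Definition fsupp f : {fset S} := finsupp (fmod_val f).
Definition fmk (D : {fset S}) (E : S -> K) : fmod :=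
  FMod [fsfun s in D => E s].
Definition fterm c s : fmod := fmk [fset s]%fset (fun=> c).

Lemma fmodP f g : (forall s, fcoef f s = fcoef g s) <-> f = g.
Proof.
by case: f g => [f] [g]; split=> [h|->//]; congr FMod; apply/fsfunP/h.
Qed.

Lemma fmkE D E s : fcoef (fmk D E) s = if s \in D then E s else 0.
Proof. exact: fsfun_fun. Qed.

Lemma fcoef_neq0 f s : (fcoef f s != 0) = (s \in fsupp f).
Proof. by rewrite /fsupp mem_finsupp. Qed.

Lemma fcoef_out f s : s \notin fsupp f -> fcoef f s = 0.
Proof. by rewrite -fcoef_neq0 negbK => /eqP. Qed.

Definition fzero : fmod := fmk fset0 (fun=> 0).
Definition fopp f := fmk (fsupp f) (fun s => - fcoef f s).
Definition fadd f g :=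
  fmk (fsupp f `|` fsupp g)%fset (fun s => fcoef f s + fcoef g s).
Definition fscale c f := fmk (fsupp f) (fun s => c * fcoef f s).

Let fzeroE s : fcoef fzero s = 0.
Proof. by rewrite fmkE in_fset0. Qed.
Let foppE f s : fcoef (fopp f) s = - fcoef f s.
Proof. by rewrite fmkE; case: ifPn => // /fcoef_out->; rewrite oppr0. Qed.
Let faddE f g s : fcoef (fadd f g) s = fcoef f s + fcoef g s.
Proof.
rewrite fmkE in_fsetU; case: ifPn => //; rewrite negb_or.
by case/andP => /fcoef_out-> /fcoef_out->; rewrite addr0.
Qed.
Let fscaleE c f s : fcoef (fscale c f) s = c * fcoef f s.
Proof. by rewrite fmkE; case: ifPn => // /fcoef_out->; rewrite mulr0. Qed.

Let faddA : associative fadd.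
Proof. by move=> f g h; apply/fmodP => s; rewrite !faddE addrA. Qed.
Let faddC : commutative fadd.
Proof. by move=> f g; apply/fmodP => s; rewrite !faddE addrC. Qed.
Let fadd0 : left_id fzero fadd.
Proof. by move=> f; apply/fmodP => s; rewrite faddE fzeroE add0r. Qed.
Let faddN : left_inverse fzero fopp fadd.
Proof. by move=> f; apply/fmodP => s; rewrite faddE fzeroE foppE addNr. Qed.
HB.instance Definition _ :=
  GRing.isZmodule.Build fmod faddA faddC fadd0 faddN.

Let fscaleA a b f : fscale a (fscale b f) = fscale (a * b) f.
Proof. by apply/fmodP => s; rewrite !fscaleE mulrA. Qed.
Let fscale1 : left_id 1 fscale.
Proof. by move=> f; apply/fmodP => s; rewrite fscaleE mul1r. Qed.
Let fscaleDr : right_distributive fscale +%R.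
Proof.
by move=> c f g; apply/fmodP => s; rewrite !(faddE, fscaleE) mulrDr.
Qed.
Let fscaleDl f : {morph fscale^~ f : a b / a + b}.
Proof.
by move=> a b; apply/fmodP => s; rewrite !(faddE, fscaleE) mulrDl.
Qed.
HB.instance Definition _ :=
  GRing.Zmodule_isLmodule.Build K fmod fscaleA fscale1 fscaleDr fscaleDl.

Lemma fcoef0 s : fcoef 0 s = 0. Proof. exact: fzeroE. Qed.
Lemma fcoefD f g s : fcoef (f + g) s = fcoef f s + fcoef g s.
Proof. exact: faddE. Qed.
Lemma fcoefN f s : fcoef (- f) s = - fcoef f s.
Proof. exact: foppE. Qed.
Lemma fcoefZ c f s : fcoef (c *: f) s = c * fcoef f s.
Proof. exact: fscaleE. Qed.
Lemma fcoef_sum (I : Type) (r : seq I) (P : pred I) (F : I -> fmod) s :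
  fcoef (\sum_(i <- r | P i) F i) s = \sum_(i <- r | P i) fcoef (F i) s.
Proof.
exact: (big_morph (fun f => fcoef f s) (fun f g => fcoefD f g s) (fcoef0 s)).
Qed.

Lemma fcoef_term c s t : fcoef (fterm c s) t = if t == s then c else 0.
Proof. by rewrite fmkE inE. Qed.

Lemma ftermD s a b : fterm (a + b) s = fterm a s + fterm b s.
Proof.
by apply/fmodP => t; rewrite fcoefD !fcoef_term; case: eqP; rewrite ?addr0.
Qed.
Lemma fterm0 s : fterm 0 s = 0.
Proof. by apply/fmodP => t; rewrite fcoef0 fcoef_term; case: eqP. Qed.
Lemma ftermZ c a s : c *: fterm a s = fterm (c * a) s.
Proof.
by apply/fmodP => t; rewrite fcoefZ !fcoef_term; case: eqP; rewrite ?mulr0.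
Qed.

Lemma fmodEw f (D : {fset S}) : (fsupp f `<=` D)%fset ->
  f = \sum_(s <- D) fterm (fcoef f s) s.
Proof.
move=> /fsubsetP fD; apply/fmodP => s; rewrite fcoef_sum.
have [sD|sD] := boolP (s \in D).
  rewrite (big_fsetD1 s) //= fcoef_term eqxx big1_fset ?addr0 // => t.
  by rewrite in_fsetD1 fcoef_term eq_sym => /andP[/negPf->].
rewrite fcoef_out ?(contra (fD s)) // big1_fset // => t tD _.
by rewrite fcoef_term; case: eqP tD sD => // -> ->.
Qed.

Lemma fmodE f : f = \sum_(s <- fsupp f) fterm (fcoef f s) s.
Proof. exact: fmodEw. Qed.

Lemma fsupp_term c s : (fsupp (fterm c s) `<=` [fset s])%fset.
Proof.
apply/fsubsetP => t; rewrite -fcoef_neq0 fcoef_term inE.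
by case: (t == s); rewrite ?eqxx.
Qed.

Lemma fsuppD f g : (fsupp (f + g)%R `<=` fsupp f `|` fsupp g)%fset.
Proof.
apply/fsubsetP => s; rewrite in_fsetU -!fcoef_neq0 fcoefD.
by apply: contraR; rewrite negb_or !negbK => /andP[/eqP-> /eqP->]; rewrite addr0.
Qed.

End FreeModule.

Arguments fcoef {K S} f s.

Section GroupAlgebra.
Variables (K : comNzRingType) (M : zmodType).

Definition grpalg : Type := fmod K M.
HB.instance Definition _ := GRing.Lmodule.on grpalg.

Implicit Types (f g h : grpalg) (m : M).

Definition gone : grpalg := fterm 1 0.
Definition gmul f g : grpalg :=
  \sum_(a <- fsupp f) \sum_(b <- fsupp g)
    fterm (fcoef f a * fcoef g b) (a + b).

Let gmulw (D E : {fset M}) f g :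
    (fsupp f `<=` D)%fset -> (fsupp g `<=` E)%fset ->
  gmul f g = \sum_(a <- D) \sum_(b <- E)
    (fterm (fcoef f a * fcoef g b) (a + b) : grpalg).
Proof.
move=> fD gE; rewrite /gmul (big_fset_incl _ fD) /=.
  apply: eq_bigr => a _; apply: big_fset_incl => // b _ /fcoef_out->.
  by rewrite mulr0 fterm0.
by move=> a _ /fcoef_out fa; rewrite big1 // => b _; rewrite fa mul0r fterm0.
Qed.

Let gmulDl : left_distributive gmul +%R.
Proof.
move=> f g h; have hh := fsubset_refl (fsupp h).
rewrite (gmulw (fsubsetUl (fsupp f) (fsupp g)) hh).
rewrite (gmulw (fsubsetUr (fsupp f) (fsupp g)) hh) (gmulw (fsuppD f g) hh).
rewrite -big_split; apply: eq_bigr => a _.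
rewrite -big_split; apply: eq_bigr => b _.
by rewrite fcoefD mulrDl ftermD.
Qed.

Let gmulC : commutative gmul.
Proof.
move=> f g; rewrite /gmul exchange_big; apply: eq_bigr => b _.
by apply: eq_bigr => a _; rewrite mulrC addrC.
Qed.

Let gmulDr : right_distributive gmul +%R.
Proof. by move=> f g h; rewrite !(gmulC f) gmulDl. Qed.

Let gmul0 f : gmul f 0 = 0.
Proof. by apply: (addrI (gmul f 0)); rewrite -gmulDr !addr0. Qed.

Let gmul_term c d a b :
  gmul (fterm c a) (fterm d b) = fterm (c * d) (a + b).
Proof.
rewrite (gmulw (fsupp_term c a) (fsupp_term d b)) !big_seq_fset1.
by rewrite !fcoef_term !eqxx.
Qed.

Let gmul_sumr f (I : Type) (r : seq I) (F : I -> grpalg) :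
  gmul f (\sum_(i <- r) F i) = \sum_(i <- r) gmul f (F i).
Proof. exact: (big_morph (gmul f) (gmulDr f) (gmul0 f)). Qed.
Let gmul_suml f (I : Type) (r : seq I) (F : I -> grpalg) :
  gmul (\sum_(i <- r) F i) f = \sum_(i <- r) gmul (F i) f.
Proof. by rewrite gmulC gmul_sumr; apply: eq_bigr => i _; rewrite gmulC. Qed.

Let gmulA : associative gmul.
Proof.
move=> f g h; rewrite [f in LHS]fmodE [f in RHS]fmodE.
rewrite (gmul_suml (gmul g h)) (gmul_suml g) (gmul_suml h).
apply: eq_bigr => a _; rewrite [g in LHS]fmodE [g in RHS]fmodE.
rewrite (gmul_suml h) !(gmul_sumr (fterm _ a)) (gmul_suml h).
apply: eq_bigr => b _; rewrite [h in LHS]fmodE [h in RHS]fmodE.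
rewrite (gmul_sumr (fterm _ b)) (gmul_sumr (fterm _ a)).
rewrite (gmul_sumr (gmul _ _)).
by apply: eq_bigr => c _; rewrite !gmul_term mulrA addrA.
Qed.

Let gmul1 : left_id gone gmul.
Proof.
move=> f; rewrite {1}(fmodE f) gmul_sumr [RHS]fmodE; apply: eq_bigr => a _.
by rewrite gmul_term mul1r add0r.
Qed.

Let gone_neq0 : gone != 0.
Proof.
apply/eqP => /fmodP/(_ 0)/eqP.
by rewrite fcoef_term eqxx fcoef0 oner_eq0.
Qed.

HB.instance Definition _ := GRing.Zmodule_isComNzRing.Build grpalg
  gmulA gmulC gmul1 gmulDl gone_neq0.

Let gscaleAl c f g : c *: (f * g) = c *: f * g.
Proof.
rewrite -[f * g]/(gmul f g) -[c *: f * g]/(gmul (c *: f) g).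
rewrite [f in LHS]fmodE [f in RHS]fmodE [in RHS]scaler_sumr.
rewrite !(gmul_suml g) scaler_sumr.
apply: eq_bigr => a _; rewrite ftermZ [g in LHS]fmodE [g in RHS]fmodE.
rewrite !(gmul_sumr (fterm _ a)) scaler_sumr; apply: eq_bigr => b _.
by rewrite !gmul_term ftermZ mulrA.
Qed.
HB.instance Definition _ := GRing.Lmodule_isLalgebra.Build K grpalg gscaleAl.
HB.instance Definition _ := GRing.Lalgebra_isComAlgebra.Build K grpalg.

Lemma grpalgM f g m : fcoef (f * g) m =
  \sum_(a <- fsupp f) \sum_(b <- fsupp g)
    (if m == a + b then fcoef f a * fcoef g b else 0).
Proof.
rewrite -[f * g]/(gmul f g) /gmul fcoef_sum; apply: eq_bigr => a _.
by rewrite fcoef_sum; apply: eq_bigr => b _; rewrite fcoef_term.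
Qed.

Definition gexp m : grpalg := fterm 1 m.

Lemma gtermM c d a b :
  (fterm c a : grpalg) * (fterm d b : grpalg) = fterm (c * d) (a + b).
Proof. exact: gmul_term. Qed.

End GroupAlgebra.

Arguments gexp {K M} m.

(* The subalgebra K[S] of K[M], for a submonoid S of M. *)
Section MonoidAlgebra.
Variables (K : comNzRingType) (M : zmodType) (S : addrClosed M).

Definition supported_in : {pred grpalg K M} :=
  [pred f : grpalg K M | all (mem S) (fsupp f)].

Lemma supported_inP (f : grpalg K M) :
  reflect (forall m, fcoef f m != 0 -> m \in S) (f \in supported_in).
Proof.
by apply: (iffP allP) => fS m; [rewrite fcoef_neq0|rewrite -fcoef_neq0]; apply: fS.
Qed.

Let supported_term c m : m \in S -> (fterm c m : grpalg K M) \in supported_in.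
Proof.
move=> mS; apply/supported_inP => a; rewrite fcoef_term.
by case: (eqVneq a m) => [->//|]; rewrite eqxx.
Qed.

Let supported_add : {in supported_in &, forall f g, f + g \in supported_in}.
Proof.
move=> f g /supported_inP fS /supported_inP gS; apply/supported_inP => m.
rewrite fcoefD; case: (eqVneq (fcoef f m) 0) => [->|/fS//].
by rewrite add0r => /gS.
Qed.

Let supported_scale c : {in supported_in, forall f, c *: f \in supported_in}.
Proof.
move=> f /supported_inP fS; apply/supported_inP => m; rewrite fcoefZ.
by case: (eqVneq (fcoef f m) 0) => [->|/fS//]; rewrite mulr0 eqxx.
Qed.

Let supported_sum (I : Type) (r : seq I) (P : pred I) (F : I -> grpalg K M) :
  (forall i, P i -> F i \in supported_in) ->
  (\sum_(i <- r | P i) F i : grpalg K M) \in supported_in.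
Proof.
move=> FS; apply: (@big_ind _ (fun f => f \in supported_in)) => //.
by apply/supported_inP => m; rewrite fcoef0 eqxx.
Qed.

Let supported_mul : {in supported_in &, forall f g, f * g \in supported_in}.
Proof.
move=> f g /allP fS /allP gS; rewrite -[f * g]/(gmul f g) /gmul.
rewrite big_seq; apply: supported_sum => a /fS aS.
by rewrite big_seq; apply: supported_sum => b /gS bS; apply/supported_term/rpredD.
Qed.

Let supported_closed : GRing.subalg_closed supported_in.
Proof.
split; first exact: supported_term (rpred0 S).
  by move=> c f g fS gS; apply: supported_add => //; apply: supported_scale.
exact: supported_mul.
Qed.
HB.instance Definition _ := GRing.isSubalgClosed.Build K (grpalg K M)
  supported_in (GRing.subalg_closed_semi supported_closed).

Record monalg : Type :=
  MonAlg { monalg_val : grpalg K M; _ : monalg_val \in supported_in }.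
HB.instance Definition _ := [isSub for monalg_val].
HB.instance Definition _ := [Choice of monalg by <:].
HB.instance Definition _ := [SubChoice_isSubLalgebra of monalg by <:].
HB.instance Definition _ := [SubNzRing_isSubComNzRing of monalg by <:].
HB.instance Definition _ := [SubLalgebra_isSubAlgebra of monalg by <:].

Lemma monalg_valD (f g : monalg) : val (f + g) = val f + val g.
Proof. exact: (raddfD (val : monalg -> grpalg K M)). Qed.
Lemma monalg_valZ c (f : monalg) : val (c *: f) = c *: val f.
Proof. by rewrite linearZ. Qed.
Lemma monalg_valM (f g : monalg) : val (f * g) = val f * val g.
Proof. exact: (rmorphM (val : monalg -> grpalg K M)). Qed.

End MonoidAlgebra.
(* The inclusion of K[S] into K[S'] when S is contained in S'. *)
Definition monalg_incl (K : comNzRingType) (M : zmodType) (S S' : addrClosed M)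
    (f : monalg K S) : monalg K S' :=
  insubd 0 (val f).

Section Derivations.
Variables (K : comNzRingType) (A : comAlgType K).

Definition is_der (D : A -> A) : Prop :=
  (forall (c : K) (f g : A), D (c *: f + g) = c *: D f + D g) /\
  (forall f g : A, D (f * g) = f * D g + g * D f).

Definition der_pred : {pred A -> A^o} := [pred D | `[< is_der D >]].

Let der_closed : subsemimod_closed der_pred.
Proof.
split; first split.
- apply/asboolP; split=> [c f g|f g]; rewrite /= ?scaler0 ?mulr0 !addr0//.
- move=> D E /asboolP[D1 D2] /asboolP[E1 E2]; apply/asboolP; split=> [c f g|f g].
    change (D (c *: f + g) + E (c *: f + g) =
      c *: (D f + E f : A) + (D g + E g : A)).
    by rewrite D1 E1 scalerDr addrACA.
  change (D (f * g) + E (f * g) = f * (D g + E g : A) + g * (D f + E f : A)).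
  by rewrite D2 E2; ring.
- move=> a D /asboolP[D1 D2]; apply/asboolP; split=> [c f g|f g].
    change (a * D (c *: f + g) = c *: (a * D f : A) + (a * D g : A)).
    by rewrite D1 mulrDr scalerAr.
  change (a * D (f * g) = f * (a * D g : A) + g * (a * D f : A)).
  by rewrite D2; ring.
Qed.
HB.instance Definition _ :=
  GRing.isSubmodClosed.Build A (A -> A^o) der_pred der_closed.

Record der : Type := MkDer { der_val :> A -> A^o; _ : der_val \in der_pred }.
HB.instance Definition _ := [isSub for der_val].
HB.instance Definition _ := [Choice of der by <:].
HB.instance Definition _ := [SubChoice_isSubLmodule of der by <:].

Lemma derP (D : der) : is_der D. Proof. exact/asboolP/(valP D). Qed.

End Derivations.

Section ExteriorPower.
Variables (A : comNzRingType) (P : lmodType A) (k : nat).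

Local Notation tuples := {ffun 'I_k -> P}.

(* x with its i-th entry replaced by u *)
Definition tset (x : tuples) (i : 'I_k) (u : P) : tuples :=
  [ffun j => if j == i then u else x j].

(* The submodule of relations making (x_i) |-> x_0 ^ ... ^ x_(k-1)
   multilinear and alternating. *)
Inductive ext_rel : fmod A tuples -> Prop :=
| ExtAdd (x : tuples) i u v : ext_rel (fterm 1 (tset x i (u + v))
    - fterm 1 (tset x i u) - fterm 1 (tset x i v))
| ExtScale (x : tuples) i a u :
    ext_rel (fterm 1 (tset x i (a *: u)) - a *: fterm 1 (tset x i u))
| ExtAlt (x : tuples) i j : i != j -> x i = x j -> ext_rel (fterm 1 x)
| ExtRel0 : ext_rel 0
| ExtRelD r s : ext_rel r -> ext_rel s -> ext_rel (r + s)
| ExtRelZ a r : ext_rel r -> ext_rel (a *: r).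

Definition ext_pred : {pred fmod A tuples} := [pred r | `[< ext_rel r >]].

Let ext_closed : zmod_closed ext_pred.
Proof.
split=> [|r s /asboolP rR /asboolP sR]; apply/asboolP; first exact: ExtRel0.
by rewrite -scaleN1r; apply: ExtRelD => //; apply: ExtRelZ.
Qed.
HB.instance Definition _ :=
  GRing.isZmodClosed.Build (fmod A tuples) ext_pred ext_closed.

Definition extpow : Type := Quotient.quot ext_pred.
HB.instance Definition _ := GRing.Zmodule.on extpow.
HB.instance Definition _ : EqQuotient _ (Quotient.equiv ext_pred) extpow :=
  EqQuotient.on extpow.

Definition ext_pi (r : fmod A tuples) : extpow := \pi_extpow r.
Definition ext_repr (w : extpow) : fmod A tuples := repr w.
Definition ext_scale (a : A) (w : extpow) : extpow := ext_pi (a *: ext_repr w).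

Lemma ext_reprK w : ext_pi (ext_repr w) = w. Proof. exact: reprK. Qed.

Lemma ext_piP r s : ext_pi r = ext_pi s <-> ext_rel (r - s).
Proof.
rewrite /ext_pi; split=> [/eqP|rs].
  by rewrite -Quotient.idealrBE => /asboolP.
by apply/eqP; rewrite -Quotient.idealrBE; apply/asboolP.
Qed.

Lemma ext_piD r s : ext_pi (r + s) = ext_pi r + ext_pi s.
Proof. by rewrite /ext_pi !piE. Qed.

Let ext_scale_pi a r : ext_scale a (ext_pi r) = ext_pi (a *: r).
Proof.
by apply/ext_piP; rewrite -scalerBr; apply/ExtRelZ/ext_piP; rewrite ext_reprK.
Qed.

Let ext_scaleA a b w : ext_scale a (ext_scale b w) = ext_scale (a * b) w.
Proof. by rewrite -(ext_reprK w) !ext_scale_pi scalerA. Qed.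
Let ext_scale1 : left_id 1 ext_scale.
Proof. by move=> w; rewrite -(ext_reprK w) ext_scale_pi scale1r. Qed.
Let ext_scaleDr : right_distributive ext_scale +%R.
Proof.
move=> a v w; rewrite -(ext_reprK v) -(ext_reprK w).
by rewrite -ext_piD !ext_scale_pi scalerDr ext_piD.
Qed.
Let ext_scaleDl w : {morph ext_scale^~ w : a b / a + b}.
Proof.
move=> a b; rewrite -(ext_reprK w) !ext_scale_pi scalerDl.
exact: ext_piD.
Qed.
HB.instance Definition _ := GRing.Zmodule_isLmodule.Build A extpow
  ext_scaleA ext_scale1 ext_scaleDr ext_scaleDl.

Definition wedge (x : tuples) : extpow := ext_pi (fterm 1 x).

Lemma ext_piZ a r : ext_pi (a *: r) = a *: ext_pi r.
Proof. by rewrite -ext_scale_pi. Qed.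

End ExteriorPower.

Arguments ext_pi {A P k} r.
Arguments ext_repr {A P k} w.

(* The k-th exterior power of a map phi semilinear with respect to rho. It is
   computed on an arbitrary representative; under the hypotheses below this is
   well defined (ext_map_pi). *)
Section ExteriorMap.
Variables (A A' : comNzRingType) (P : lmodType A) (P' : lmodType A') (k : nat).
Variables (rho : A -> A') (phi : P -> P').

Definition ext_push (r : fmod A {ffun 'I_k -> P}) : fmod A' {ffun 'I_k -> P'} :=
  \sum_(x <- fsupp r) fterm (rho (fcoef r x)) [ffun i => phi (x i)].

Definition ext_map (w : extpow P k) : extpow P' k :=
  ext_pi (ext_push (ext_repr w)).

Hypotheses (rho1 : rho 1 = 1) (rhoD : {morph rho : a b / a + b})
  (rhoM : {morph rho : a b / a * b}).
Hypotheses (phiD : {morph phi : u v / u + v})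
  (phiZ : forall a u, phi (a *: u) = rho a *: phi u).

Let rho0 : rho 0 = 0.
Proof. by apply: (addrI (rho 0)); rewrite -rhoD !addr0. Qed.

Local Notation push_tuple x := [ffun i => phi (x i)].

Let ext_pushw (D : {fset {ffun 'I_k -> P}}) r : (fsupp r `<=` D)%fset ->
  ext_push r = \sum_(x <- D) fterm (rho (fcoef r x)) (push_tuple x).
Proof.
move=> rD; rewrite /ext_push (big_fset_incl _ rD) //= => x _ /fcoef_out->.
by rewrite rho0 fterm0.
Qed.

Lemma ext_pushD r s : ext_push (r + s) = ext_push r + ext_push s.
Proof.
rewrite (ext_pushw (fsuppD r s)) (ext_pushw (fsubsetUl (fsupp r) (fsupp s))).
rewrite (ext_pushw (fsubsetUr (fsupp r) (fsupp s))) -big_split.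
by apply: eq_bigr => x _; rewrite fcoefD rhoD ftermD.
Qed.

Lemma ext_pushZ a r : ext_push (a *: r) = rho a *: ext_push r.
Proof.
have sr : (fsupp (a *: r)%R `<=` fsupp r)%fset.
  apply/fsubsetP => x; rewrite -!fcoef_neq0 fcoefZ.
  by apply: contraNneq => ->; rewrite mulr0.
rewrite (ext_pushw sr) scaler_sumr; apply: eq_bigr => x _.
by rewrite fcoefZ rhoM ftermZ.
Qed.

Lemma ext_push_term a x :
  ext_push (fterm a x) = fterm (rho a) (push_tuple x).
Proof.
by rewrite (ext_pushw (fsupp_term a x)) big_seq_fset1 fcoef_term eqxx.
Qed.

Let ext_pushN r : ext_push (- r) = - ext_push r.
Proof.
apply: (addIr (ext_push r)); rewrite -ext_pushD !addNr.
by rewrite /ext_push big1_fset // => x _ _; rewrite fcoef0 rho0 fterm0.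
Qed.

Let push_tset (x : {ffun 'I_k -> P}) i u :
  push_tuple (tset x i u) = tset (push_tuple x) i (phi u).
Proof. by apply/ffunP => j; rewrite !ffunE; case: ifP. Qed.

Let ext_push_rel r : ext_rel r -> ext_rel (ext_push r).
Proof.
elim=> [x i u v|x i a u|x i j ij xij||{}r s _ rR _ sR|a {}r _ rR].
- rewrite !(ext_pushD, ext_pushN) !ext_push_term !push_tset phiD rho1.
  exact: ExtAdd.
- rewrite ext_pushD ext_pushN ext_pushZ !ext_push_term !push_tset phiZ rho1.
  exact: ExtScale.
- rewrite ext_push_term rho1; apply: (ExtAlt ij).
  by rewrite !ffunE xij.
- by rewrite -(subr0 0) ext_pushD ext_pushN subrr; exact: ExtRel0.
- by rewrite ext_pushD; exact: ExtRelD.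
- by rewrite ext_pushZ; exact: ExtRelZ.
Qed.

Lemma ext_map_pi r : ext_map (ext_pi r) = ext_pi (ext_push r).
Proof.
apply/ext_piP; rewrite -ext_pushN -ext_pushD; apply/ext_push_rel/ext_piP.
exact: ext_reprK.
Qed.

Lemma ext_map_wedge x : ext_map (wedge x) = wedge (push_tuple x).
Proof. by rewrite ext_map_pi ext_push_term rho1. Qed.

Lemma ext_mapD v w : ext_map (v + w) = ext_map v + ext_map w.
Proof.
rewrite -(ext_reprK v) -(ext_reprK w) -ext_piD !ext_map_pi.
by rewrite ext_pushD ext_piD.
Qed.

Lemma ext_mapZ a w : ext_map (a *: w) = rho a *: ext_map w.
Proof.
by rewrite -(ext_reprK w) -ext_piZ !ext_map_pi ext_pushZ ext_piZ.
Qed.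

End ExteriorMap.

Section LinearAlgebra.
Variables (K : fieldType) (E : lmodType K).
Implicit Types (V S : set E) (d : nat).

Definition lspan S : set E :=
  [set v | exists d (c : 'I_d -> K) (w : 'I_d -> E),
     (forall i, S (w i)) /\ v = \sum_i c i *: w i].

Definition is_basis V d (b : 'I_d -> E) : Prop :=
  (forall c : 'I_d -> K, \sum_i c i *: b i = 0 -> forall i, c i = 0) /\
  V = lspan (range b).

(* Equal to 0 when V is not a finite-dimensional subspace. *)
Definition subdim V : nat :=
  xget 0%N [set d | exists b : 'I_d -> E, is_basis V b].

End LinearAlgebra.

(* N = Z^n is the lattice of integral column vectors, and M = Hom(N, Z) that of
   integral row vectors. *)
Notation latN n := 'cV[int]_n.
Notation latM n := 'rV[int]_n.

Section Lattice.
Variable n : nat.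

Definition pairing (K : comNzRingType) (u : 'rV[K]_n) (v : 'cV[K]_n) : K :=
  (u *m v) 0 0.
Definition extN (K : comNzRingType) (v : latN n) : 'cV[K]_n := map_mx intr v.
Definition extM (K : comNzRingType) (m : latM n) : 'rV[K]_n := map_mx intr m.

End Lattice.

Section Torus.
Variables (F : fieldType) (n : nat).

(* T = N (x) F^* = (F^* )^n *)
Record torus : Type :=
  Torus { torus_val : 'cV[F]_n; _ : [forall i, torus_val i 0 != 0] }.
HB.instance Definition _ := [isSub for torus_val].

Implicit Types (s t : torus) (m : latM n).

Lemma torus_neq0 t i : val t i 0 != 0.
Proof. by case: t => t /= /forallP/(_ i). Qed.

Let torus1_subproof : [forall i, (const_mx 1 : 'cV[F]_n) i 0 != 0].
Proof. by apply/forallP => i; rewrite mxE oner_neq0. Qed.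
Definition torus1 : torus := Torus torus1_subproof.

Let torusM_subproof s t :
  [forall i, (\col_j (val s j 0 * val t j 0) : 'cV[F]_n) i 0 != 0].
Proof. by apply/forallP => i; rewrite mxE mulf_neq0 // torus_neq0. Qed.
Definition torusM s t : torus := Torus (torusM_subproof s t).

Let torusV_subproof t : [forall i, (map_mx GRing.inv (val t)) i 0 != 0].
Proof. by apply/forallP => i; rewrite mxE invr_neq0 // torus_neq0. Qed.
Definition torusV t : torus := Torus (torusV_subproof t).

Definition chi m t : F := \prod_i val t i 0 ^ m 0 i.

Lemma chi_neq0 m t : chi m t != 0.
Proof. by apply/prodf_neq0 => i _; rewrite expfz_neq0 ?torus_neq0. Qed.

Lemma chi0 t : chi 0 t = 1.
Proof. by rewrite /chi big1 // => i _; rewrite mxE expr0z. Qed.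

Lemma chiD m m' t : chi (m + m') t = chi m t * chi m' t.
Proof.
rewrite /chi -big_split; apply: eq_bigr => i _.
by rewrite mxE expfzDr ?torus_neq0.
Qed.

Lemma chiV m t : chi m (torusV t) = (chi m t)^-1.
Proof.
rewrite /chi -prodfV; apply: eq_bigr => i _.
by rewrite mxE expfV.
Qed.

(* Value at t of a Laurent polynomial, i.e. of a regular function on T. *)
Definition laurent_eval (f : grpalg F (latM n)) t : F :=
  \sum_(m <- fsupp f) fcoef f m * chi m t.

(* Pullback of functions by the translation by t: the pullback of the function
   chi^m is chi^m(t) chi^m. *)
Definition gpull t (f : grpalg F (latM n)) : grpalg F (latM n) :=
  fmk (fsupp f) (fun m => chi m t * fcoef f m).

Lemma gpullE t f m : fcoef (gpull t f) m = chi m t * fcoef f m.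
Proof. by rewrite fmkE; case: ifPn => // /fcoef_out->; rewrite mulr0. Qed.

Lemma gpull_linear t c f g : gpull t (c *: f + g) = c *: gpull t f + gpull t g.
Proof.
apply/fmodP => m; rewrite fcoefD fcoefZ !gpullE fcoefD fcoefZ.
by rewrite mulrDr mulrCA.
Qed.

Lemma gpullM t f g : gpull t (f * g) = gpull t f * gpull t g.
Proof.
have supp h : fsupp (gpull t h) = fsupp h.
  apply/fsetP => m; rewrite -!fcoef_neq0 gpullE mulf_eq0 negb_or.
  by rewrite chi_neq0.
apply/fmodP => m; rewrite gpullE !grpalgM !supp mulr_sumr.
apply: eq_bigr => a _; rewrite mulr_sumr; apply: eq_bigr => b _.
rewrite !gpullE; case: eqP => [->|_]; last by rewrite mulr0.
by rewrite chiD mulrACA.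
Qed.

Section Translation.
Variable S : addrClosed (latM n).

Let tpull_subproof t (f : monalg F S) : gpull t (val f) \in supported_in S.
Proof.
apply/supported_inP => m; rewrite gpullE mulf_eq0 negb_or => /andP[_].
by move: m; apply/supported_inP/(valP f).
Qed.
Definition tpull t (f : monalg F S) : monalg F S :=
  MonAlg (tpull_subproof t f).

Lemma tpull_val t (f : monalg F S) : val (tpull t f) = gpull t (val f).
Proof. by []. Qed.

Lemma tpull_linear t c (f g : monalg F S) :
  tpull t (c *: f + g) = c *: tpull t f + tpull t g.
Proof.
apply: val_inj; rewrite !(tpull_val, monalg_valD, monalg_valZ).
exact: gpull_linear.
Qed.

Lemma tpullD t (f g : monalg F S) : tpull t (f + g) = tpull t f + tpull t g.
Proof. by rewrite -{1}[f]scale1r tpull_linear scale1r. Qed.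

Lemma tpullM t (f g : monalg F S) : tpull t (f * g) = tpull t f * tpull t g.
Proof. by apply: val_inj; rewrite !(tpull_val, monalg_valM) gpullM. Qed.

Lemma tpullK t : cancel (tpull t) (tpull (torusV t)).
Proof.
by move=> f; apply/val_inj/fmodP => m; rewrite /= !gpullE chiV mulKf ?chi_neq0.
Qed.

Lemma tpullVK t : cancel (tpull (torusV t)) (tpull t).
Proof.
by move=> f; apply/val_inj/fmodP => m; rewrite /= !gpullE chiV mulVKf ?chi_neq0.
Qed.

(* Pushforward of vector fields by the translation by t. *)
Let der_push_subproof t (D : der (monalg F S)) :
  (fun f => tpull (torusV t) (D (tpull t f))) \in @der_pred F (monalg F S).
Proof.
have [D1 D2] := derP D; apply/asboolP; split=> [c f g|f g].
  by rewrite tpull_linear D1; exact: tpull_linear.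
have -> : tpull t (f * g) = tpull t f * tpull t g by exact: tpullM.
by rewrite D2 tpullD !tpullM !tpullK.
Qed.
Definition der_push t (D : der (monalg F S)) : der (monalg F S) :=
  MkDer (der_push_subproof t D).

End Translation.
End Torus.

Section Representations.
Variables (F : fieldType) (n : nat) (E : lmodType F).
Variables (act : torus F n -> E -> E) (V : set E).

Definition weight_space (m : latM n) : set E :=
  [set v | V v /\ forall t, act t v = chi m t *: v].

(* The sum has finite support when V is a finite-dimensional rational
   representation. *)
Definition formal_char : grpalg int (latM n) :=
  \sum_(m \in [set: latM n]) ((subdim (weight_space m))%:Z *: gexp m).

(* The matrix coefficients of a rational representation are regular functions
   on T. *)
Definition fd_rational_rep : Prop :=
  [/\ forall t v, V v -> V (act t v),
      forall v, V v -> act (torus1 F n) v = v,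
      forall s t v, V v -> act (torusM s t) v = act s (act t v),
      forall t c v w, V v -> V w -> act t (c *: v + w) = c *: act t v + act t w
    & exists d (b : 'I_d -> E) (a : 'I_d -> 'I_d -> grpalg F (latM n)),
        is_basis V b /\
        forall t j, act t (b j) = \sum_i laurent_eval (a i j) t *: b i].

End Representations.

Section Fans.
Variables (R : realType) (n : nat).
Implicit Types (sigma tau rho : set 'cV[R]_n) (Delta : set (set 'cV[R]_n)).

Definition cone (s : seq (latN n)) : set 'cV[R]_n :=
  [set x | exists c : 'I_(size s) -> R,
     (forall i, 0 <= c i) /\ x = \sum_i c i *: extN R s`_i].

Definition strongly_convex sigma : Prop :=
  forall x, sigma x -> sigma (- x) -> x = 0.

Definition is_face tau sigma : Prop :=
  exists u : 'rV[R]_n, (forall x, sigma x -> 0 <= pairing u x) /\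
    tau = sigma `&` [set x | pairing u x = 0].

Record is_fan Delta : Prop := IsFan {
  fan_finite : finite_set Delta;
  fan_rational : forall sigma, Delta sigma -> exists s, sigma = cone s;
  fan_strongly_convex : forall sigma, Delta sigma -> strongly_convex sigma;
  fan_face : forall sigma tau, Delta sigma -> is_face tau sigma -> Delta tau;
  fan_setI : forall sigma tau, Delta sigma -> Delta tau ->
    is_face (sigma `&` tau) sigma /\ is_face (sigma `&` tau) tau }.

(* Each cone is generated by part of a Z-basis of N. *)
Definition smooth_fan Delta : Prop :=
  forall sigma, Delta sigma -> exists (B : 'M[int]_n) (J : {set 'I_n}),
    B \in unitmx /\ sigma = cone [seq col j B | j <- enum J].

Definition complete_fan Delta : Prop :=
  forall x, exists2 sigma, Delta sigma & sigma x.

Definition rays Delta : set (set 'cV[R]_n) :=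
  [set rho | Delta rho /\ subdim (lspan rho) = 1%N].

(* The primitive generator of rho: the generator of the monoid of lattice
   points of rho. *)
Definition prim_gen rho : latN n :=
  xget 0 [set v | forall w : latN n,
            rho (extN R w) <-> exists k : nat, w = v *+ k].

Definition anticanonical_polytope Delta : set 'rV[R]_n :=
  [set u | forall rho, rays Delta rho ->
             -1 <= pairing u (extN R (prim_gen rho))].

Definition anticanonical_points Delta : set (latM n) :=
  [set m | anticanonical_polytope Delta (extM R m)].

(* The subspace L_u of N (x) C, and its dimension i(u). *)
Definition span_at Delta (u : 'rV[R]_n) : set 'cV[R[i]]_n :=
  lspan [set extN R[i] (prim_gen rho) |
    rho in [set rho | rays Delta rho /\
                      pairing u (extN R (prim_gen rho)) = -1]].

Definition span_dim Delta (u : 'rV[R]_n) : nat := subdim (span_at Delta u).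

Definition dual_monoid sigma : {pred latM n} :=
  [pred m | `[< forall x, sigma x -> 0 <= pairing (extM R m) x >]].

Let dual_monoid_closed sigma : GRing.nmod_closed (dual_monoid sigma).
Proof.
split=> [|m m' /asboolP ms /asboolP m's]; apply/asboolP => x sx.
  by rewrite /pairing /extM raddf0 mul0mx mxE.
by rewrite /pairing /extM raddfD mulmxDl mxE addr_ge0 ?ms ?m's.
Qed.
HB.instance Definition _ sigma := GRing.isAddClosed.Build (latM n)
  (dual_monoid sigma) (dual_monoid_closed sigma).

(* The coordinate ring C[sigma^vee :&: M] of the affine chart U_sigma. *)
Definition chart sigma : comAlgType R[i] := monalg R[i] (dual_monoid sigma).

End Fans.

Section PolyvectorFields.
Variables (R : realType) (n : nat) (Delta : set (set 'cV[R]_n)) (k : nat).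
Implicit Types (sigma tau : set 'cV[R]_n).

(* Sections of the k-th exterior power of the tangent sheaf over the affine
   chart U_sigma = Spec C[sigma^vee :&: M]. *)
Definition polyvec sigma : lmodType (chart sigma) :=
  extpow (der (chart sigma)) k.

(* For a face tau of sigma, U_tau is a principal open subset of U_sigma, and
   every derivation of its coordinate ring extends uniquely to that of U_tau. *)
Definition restr_fun sigma tau : chart sigma -> chart tau :=
  @monalg_incl _ _ (dual_monoid sigma) (dual_monoid tau).

Definition restr_der sigma tau (D : der (chart sigma)) : der (chart tau) :=
  xget 0 [set D' : der (chart tau) |
            forall f, D' (restr_fun tau f) = restr_fun tau (D f)].

Definition restr sigma tau : polyvec sigma -> polyvec tau :=
  ext_map (@restr_fun sigma tau) (@restr_der sigma tau).

(* Arbitrary families of local sections, one for each chart. *)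
Definition local_families : Type :=
  forall a : Delta, polyvec (set_val a).

HB.instance Definition _ := gen_eqMixin local_families.
HB.instance Definition _ := gen_choiceMixin local_families.

Implicit Types (s : local_families) (c : R[i]).

Definition lf0 : local_families := fun=> 0.
Definition lfN s : local_families := fun a => - s a.
Definition lfD s s' : local_families := fun a => s a + s' a.
Definition lfZ c s : local_families := fun a => c%:A *: s a.

Let lfA : associative lfD.
Proof. by move=> ? ? ?; apply: functional_extensionality_dep => ?; exact: addrA. Qed.
Let lfC : commutative lfD.
Proof. by move=> ? ?; apply: functional_extensionality_dep => ?; exact: addrC. Qed.
Let lf0D : left_id lf0 lfD.
Proof. by move=> ?; apply: functional_extensionality_dep => ?; exact: add0r. Qed.
Let lfND : left_inverse lf0 lfN lfD.
Proof. by move=> ?; apply: functional_extensionality_dep => ?; exact: addNr. Qed.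
HB.instance Definition _ := GRing.isZmodule.Build local_families lfA lfC lf0D lfND.

Let lfZA a b s : lfZ a (lfZ b s) = lfZ (a * b) s.
Proof.
apply: functional_extensionality_dep => i.
by rewrite /lfZ scalerA -scalerAl mul1r scalerA.
Qed.
Let lfZ1 : left_id 1 lfZ.
Proof.
move=> s; apply: functional_extensionality_dep => i.
by rewrite /lfZ !scale1r.
Qed.
Let lfZDr : right_distributive lfZ +%R.
Proof.
by move=> c s s'; apply: functional_extensionality_dep => ?; exact: scalerDr.
Qed.
Let lfZDl s : {morph lfZ^~ s : a b / a + b}.
Proof.
move=> a b; apply: functional_extensionality_dep => i.
by rewrite /lfZ scalerDl scalerDl.
Qed.
HB.instance Definition _ :=
  GRing.Zmodule_isLmodule.Build R[i] local_families lfZA lfZ1 lfZDr lfZDl.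

(* H^0(X_Delta, wedge^k T). As X_Delta is the union of the U_sigma, glued along
   U_sigma :&: U_tau = U_(sigma :&: tau), a global section is a family of
   sections over the charts compatible with restriction to faces. *)
Definition H0 : set local_families :=
  [set s | forall a b : Delta, is_face (set_val b) (set_val a) ->
     restr (set_val b) (s a) = s b].

(* (t . s)(p) = t_* (s (t^-1 p)): functions are pushed forward by f |-> f o t^-1,
   and vector fields by D |-> (f |-> D (f o t) o t^-1). *)
Definition torus_act (t : torus R[i] n) s : local_families :=
  fun a => ext_map (@tpull _ _ _ (torusV t)) (@der_push _ _ _ t) (s a).

End PolyvectorFields.

Arguments H0 {R n} Delta k _.
Arguments torus_act {R n} Delta k t s _.

(* Main.v *)
Require Import Defs.
From HB Require Import structures.
From mathcomp Require Import all_boot all_order all_algebra.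
From mathcomp Require Import all_fingroup.
From mathcomp Require Import finmap.
From mathcomp Require Import generic_quotient ring_quotient.
From mathcomp Require Import all_classical all_reals.
From mathcomp Require Import complex.
From mathcomp Require Import ring.

Set Implicit Arguments.
Unset Strict Implicit.
Unset Printing Implicit Defensive.

Import Order.TTheory GRing.Theory Num.Theory.
Local Open Scope classical_set_scope.
Local Open Scope quotient_scope.
Local Open Scope ring_scope.

(* The chart U_sigma of a smooth cone generated by b_j (j in J), with dual basis
   b*_j, has as derivations the free module on chi^(-b*_j) d_(b_j) for j in J and
   d_(b_j) for j not in J, where d_v chi^m = <m, v> chi^m. Restriction to the torus
   is therefore injective on polyvector fields, and a field sum_m chi^m w_m on the
   torus, with w_m in the k-th exterior power of N (x) C, extends to U_sigma iff,
   for all m and j in J, w_m = 0 when <m, b_j> < -1 and w_m is divisible by b_j when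
   <m, b_j> = -1. Divisibility by b_j is tested by evaluating w_m on k-tuples of
   linear forms vanishing on b_j, which does not refer to a basis. Hence the global
   fields of weight -m are zero unless m is in P_Delta, and are otherwise the chi^m w
   with w divisible by the top exterior power of L_m, a space with a basis indexed by
   the k-subsets of a basis of N (x) C that contain a given basis of L_m. *)

(** * Exterior powers *)

(** The generators v with <m, v> = -1 need not lie in one cone, nor be independent, so in general no
    chart basis is adapted to L_m: each chart states regularity in its own integral basis, while the
    sections of weight -m are seen in a complex basis that varies with m. The two are linked by
    evaluating fields on all k-tuples of invariant 1-forms, given by a matrix [xi]; in either basis
    the values are combinations of the minors of [xi] times the basis matrix ([plm_expand]).
    Determinants thus also provide the independence of wedge products. The maps between charts are
    defined through chosen representatives and chosen extensions; they are controlled by uniqueness: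
    a derivation is known from its values on the monomials of the dual basis. The torus is the chart
    of the cone 0, whose monoid is M only up to a proof; it enters as a monoid [S0] with [S0T]. The
    factor q^i (1+q)^(n-i) collects the numbers 'C(n - i, k - i) of k-subsets of n indices
    containing i given ones. *)

Section ExteriorBasis.
Variables (A : comNzRingType) (P : lmodType A) (k : nat).
Local Notation tuples := {ffun 'I_k -> P}.

Lemma ext_pi_rel (r : fmod A tuples) : ext_rel r -> ext_pi r = 0.
Proof.
move=> rR; apply: (addrI (ext_pi r)); rewrite -ext_piD addr0.
by apply/ext_piP; rewrite addrK.
Qed.

Lemma ext_pi0 : ext_pi (0 : fmod A tuples) = 0.
Proof. exact/ext_pi_rel/ExtRel0. Qed.

Lemma ext_piN (r : fmod A tuples) : ext_pi (- r) = - ext_pi r.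
Proof. by apply: (addIr (ext_pi r)); rewrite -ext_piD !addNr ext_pi0. Qed.

Lemma wedge_tsetD (x : tuples) i u v :
  wedge (tset x i (u + v)) = wedge (tset x i u) + wedge (tset x i v).
Proof.
apply/eqP; rewrite -subr_eq0 opprD addrA -!ext_piN -!ext_piD.
exact/eqP/ext_pi_rel/ExtAdd.
Qed.

Lemma wedge_tsetZ (x : tuples) i a u :
  wedge (tset x i (a *: u)) = a *: wedge (tset x i u).
Proof.
apply/eqP; rewrite -subr_eq0 -ext_piZ -ext_piN -ext_piD.
exact/eqP/ext_pi_rel/ExtScale.
Qed.

Lemma wedge_alt (x : tuples) i j : i != j -> x i = x j -> wedge x = 0.
Proof. by move=> ij xij; exact/ext_pi_rel/ExtAlt/xij. Qed.

Lemma ext_ind (W : extpow P k -> Prop) :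
  W 0 -> (forall v w, W v -> W w -> W (v + w)) ->
  (forall a w, W w -> W (a *: w)) -> (forall x, W (wedge x)) -> forall w, W w.
Proof.
move=> W0 WD WZ Wx w; rewrite -(ext_reprK w) [ext_repr w]fmodE.
apply: (big_ind (fun r => W (ext_pi r))) => [|r s rW sW|x _]; first by rewrite ext_pi0.
  by rewrite ext_piD; exact: WD.
by rewrite -[fcoef _ _]mulr1 -ftermZ ext_piZ; apply: WZ; exact: Wx.
Qed.

Lemma tset_id (x : tuples) i : tset x i (x i) = x.
Proof. by apply/ffunP => j; rewrite ffunE; case: eqP => [->|]. Qed.

Lemma wedge_tset0 (x : tuples) i : wedge (tset x i 0) = 0.
Proof. by rewrite -[0 in LHS](scale0r 0) wedge_tsetZ scale0r. Qed.

Lemma wedge_tset_sum (x : tuples) i (I : Type) (r : seq I) (F : I -> P) :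
  wedge (tset x i (\sum_(l <- r) F l)) = \sum_(l <- r) wedge (tset x i (F l)).
Proof.
apply: (big_morph (fun u => wedge (tset x i u))) => [u v|].
  exact: wedge_tsetD.
exact: wedge_tset0.
Qed.

(** Expanding the vanishing wedge with [x i + x j] in both slots [i] and [j] leaves only the two
    mixed terms. *)
Lemma wedge_tperm (x : tuples) i j : i != j ->
  wedge [ffun l => x (tperm i j l)] = - wedge x.
Proof.
move=> ij; pose y a b : tuples := tset (tset x i a) j b.
have yC a b : y a b = tset (tset x j b) i a.
  apply/ffunP => l; rewrite !ffunE; case: (eqVneq l j) => // ->.
  by rewrite eq_sym (negPf ij).
have yii a : wedge (y a a) = 0.
  by apply: (wedge_alt ij); rewrite !ffunE !eqxx (negPf ij).
have yD a a' b : wedge (y (a + a') b) = wedge (y a b) + wedge (y a' b).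
  by rewrite !yC wedge_tsetD.
have := yii (x i + x j); rewrite [y _ _]/y wedge_tsetD -!/(y _ _) !yD !yii.
rewrite add0r addr0 => /eqP; rewrite addr_eq0 => /eqP.
have -> : y (x i) (x j) = x.
  by apply/ffunP => l; rewrite !ffunE; case: (eqVneq l j) => [->//|_];
     case: (eqVneq l i) => [->|].
move=> <-; congr wedge; apply/ffunP => l; rewrite !ffunE.
case: tpermP => [->|->|/eqP/negPf li /eqP/negPf lj]; rewrite ?eqxx ?(negPf ij)//.
by rewrite li lj.
Qed.

(** The sign is left as an unspecified scalar, since the lemma only serves to prove spanning. *)
Lemma wedge_perm (x : tuples) (s : 'S_k) :
  exists c : A, wedge [ffun l => x (s l)] = c *: wedge x.
Proof.
have [ts -> _] := prod_tpermP s; elim: ts x => [|[i j] ts IH] x.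
  exists 1; rewrite scale1r; congr wedge; apply/ffunP => l.
  by rewrite ffunE big_nil perm1.
have [c Ec] := IH x; rewrite big_cons /=.
have -> : [ffun l => x ((tperm i j * \prod_(t <- ts) tperm t.1 t.2)%g l)] =
    [ffun l => [ffun l => x ((\prod_(t <- ts) tperm t.1 t.2)%g l)] (tperm i j l)].
  by apply/ffunP => l; rewrite !ffunE permM.
have [->|ij] := eqVneq i j.
  by exists c; rewrite -Ec; congr wedge; apply/ffunP => l; rewrite !ffunE tperm1 perm1.
by exists (- c); rewrite wedge_tperm // Ec scaleNr.
Qed.

Section Basis.
Variables (n : nat) (kn : (k <= n)%N).

(* Meant for k-subsets: the default value of nth is then irrelevant. *)
Definition enumI (I : {set 'I_n}) (j : 'I_k) : 'I_n :=
  nth (widen_ord kn j) (enum I) j.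

Lemma enumIE (I : {set 'I_n}) x0 (j : 'I_k) : #|I| = k ->
  enumI I j = nth x0 (enum I) j.
Proof. by move=> cI; apply: set_nth_default; rewrite -cardE cI. Qed.

Lemma enumI_in (I : {set 'I_n}) j : #|I| = k -> enumI I j \in I.
Proof.
by move=> cI; rewrite -mem_enum (mem_nth) // -cardE cI.
Qed.

Lemma enumI_inj (I : {set 'I_n}) : #|I| = k -> injective (enumI I).
Proof.
move=> cI i j; rewrite (enumIE (widen_ord kn j) i cI) /enumI => /eqP.
by rewrite nth_uniq ?enum_uniq -?cardE ?cI // => /eqP/val_inj.
Qed.

Lemma enumI_onto (I : {set 'I_n}) i : #|I| = k -> i \in I ->
  exists j, enumI I j = i.
Proof.
move=> cI iI; have lt : (index i (enum I) < k)%N.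
  by rewrite -cI cardE index_mem mem_enum.
by exists (Ordinal lt); rewrite (enumIE i _ cI) /= nth_index // mem_enum.
Qed.

Variables (e : 'I_n -> P).

Definition wedgeI (I : {set 'I_n}) : extpow P k := wedge [ffun j => e (enumI I j)].

Let spanned w :=
  exists a : {set 'I_n} -> A, w = \sum_(I : {set 'I_n} | #|I| == k) a I *: wedgeI I.

Let spanned0 : spanned 0.
Proof. by exists (fun=> 0); rewrite big1 // => I _; rewrite scale0r. Qed.

Let spannedD v w : spanned v -> spanned w -> spanned (v + w).
Proof.
move=> [a ->] [b ->]; exists (fun I => a I + b I).
by rewrite -big_split; apply: eq_bigr => I _; rewrite scalerDl.
Qed.

Let spannedZ c w : spanned w -> spanned (c *: w).
Proof.
move=> [a ->]; exists (fun I => c * a I).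
by rewrite scaler_sumr; apply: eq_bigr => I _; rewrite scalerA.
Qed.

Let spanned_wedgeI (I : {set 'I_n}) : #|I| = k -> spanned (wedgeI I).
Proof.
move=> cI; exists (fun J => (J == I)%:R).
rewrite (bigD1 I) ?cI //= eqxx scale1r big1 ?addr0 // => J /andP[_ /negPf->].
by rewrite scale0r.
Qed.

Let spanned_fun (f : {ffun 'I_k -> 'I_n}) : spanned (wedge [ffun j => e (f j)]).
Proof.
have [/injectiveP fI|] := boolP (injectiveb f); last first.
  move=> /injectivePn[i [j ij fij]]; suff -> : wedge [ffun l => e (f l)] = 0 by [].
  by apply: (wedge_alt ij); rewrite !ffunE fij.
pose I := imset f (mem 'I_k).
have cI : #|I| = k by rewrite card_imset // card_ord.
have sI : size (enum I) == k by rewrite -cardE cI.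
(* An injective [f] lists its image [I] in some order, hence is the standard enumeration of [I]
   after a permutation. *)
have /tuple_permP[s Es] : perm_eq [tuple f j | j < k] (Tuple sI).
  apply: uniq_perm => /=; first by rewrite map_inj_uniq ?enum_uniq.
    exact: enum_uniq.
  move=> l; rewrite mem_enum; apply/mapP/imsetP => [[j _ ->]|[j _ ->]]; exists j => //.
  by rewrite mem_enum.
have Ef j : f j = enumI I (s j).
  have /(congr1 (fun t => tnth t j)) := val_inj Es.
  rewrite !tnth_mktuple => ->.
  by rewrite (enumIE (f j) _ cI) (tnth_nth (f j)).
have [c Ec] := wedge_perm [ffun j => e (enumI I j)] s.
suff -> : wedge [ffun j => e (f j)] = c *: wedgeI I by exact/spannedZ/spanned_wedgeI.
by rewrite -Ec; congr wedge; apply/ffunP => j; rewrite !ffunE Ef.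
Qed.

(** The slots are expanded one at a time: the induction on [m] treats the wedges whose slots from
    [m] on are already among the [e l]. *)
Lemma wedgeI_span (y : P -> 'I_n -> A) :
    (forall u, u = \sum_i y u i *: e i) ->
  forall w, exists a : {set 'I_n} -> A,
    w = \sum_(I : {set 'I_n} | #|I| == k) a I *: wedgeI I.
Proof.
move=> ey; apply: ext_ind spanned0 spannedD spannedZ _ => x.
suff: forall m (x : tuples), (forall i : 'I_k, (m <= i)%N -> exists l, x i = e l) ->
    spanned (wedge x).
  by move=> /(_ k x); apply=> i; rewrite leqNgt ltn_ord.
elim=> [|m IH] {}x xe.
  have /choice [f Ef] : forall i : 'I_k, exists l, x i = e l by move=> i; exact: xe.
  suff -> : x = [ffun j => e ([ffun j => f j] j)] by exact: spanned_fun.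
  by apply/ffunP => j; rewrite !ffunE Ef.
have [mk|km] := ltnP m k; last first.
  by apply: IH => i mi; have := leq_trans km mi; rewrite leqNgt ltn_ord.
pose i := Ordinal mk; rewrite -(tset_id x i) [x i]ey wedge_tset_sum.
elim/big_ind: _ => // l _; rewrite wedge_tsetZ; apply/spannedZ/IH => j mj.
rewrite ffunE; case: (eqVneq j i) => [_|ji]; first by exists l.
by apply: xe; rewrite ltn_neqAle eq_sym mj andbT; apply: contraNneq ji => E; apply/eqP/val_inj.
Qed.

End Basis.

Section Lift.
Variable phi : tuples -> A.
Hypothesis phiD : forall x i u v, phi (tset x i (u + v)) = phi (tset x i u) + phi (tset x i v).
Hypothesis phiZ : forall x i a u, phi (tset x i (a *: u)) = a * phi (tset x i u).
Hypothesis phi_alt : forall (x : tuples) i j, i != j -> x i = x j -> phi x = 0.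

Let flift (r : fmod A tuples) : A := \sum_(x <- fsupp r) fcoef r x * phi x.

Let fliftw (D : {fset tuples}) r : (fsupp r `<=` D)%fset ->
  flift r = \sum_(x <- D) fcoef r x * phi x.
Proof.
move=> rD; rewrite /flift (big_fset_incl _ rD) //= => x _ /fcoef_out->.
by rewrite mul0r.
Qed.

Let fliftD r s : flift (r + s) = flift r + flift s.
Proof.
rewrite (fliftw (fsuppD r s)) (fliftw (fsubsetUl (fsupp r) (fsupp s))).
rewrite (fliftw (fsubsetUr (fsupp r) (fsupp s))) -big_split.
by apply: eq_bigr => x _; rewrite fcoefD mulrDl.
Qed.

Let fliftZ a r : flift (a *: r) = a * flift r.
Proof.
have sr : (fsupp (a *: r)%R `<=` fsupp r)%fset.
  apply/fsubsetP => x; rewrite -!fcoef_neq0 fcoefZ.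
  by apply: contraNneq => ->; rewrite mulr0.
rewrite (fliftw sr) mulr_sumr; apply: eq_bigr => x _.
by rewrite fcoefZ mulrA.
Qed.

Let flift_term x : flift (fterm 1 x) = phi x.
Proof. by rewrite (fliftw (fsupp_term 1 x)) big_seq_fset1 fcoef_term eqxx mul1r. Qed.

Let fliftN r : flift (- r) = - flift r.
Proof. by rewrite -scaleN1r fliftZ mulN1r. Qed.

Let flift_rel r : ext_rel r -> flift r = 0.
Proof.
elim=> [x i u v|x i a u|x i j ij xij||{}r s _ rR _ sR|a {}r _ rR].
- by rewrite !fliftD !fliftN !flift_term phiD -addrA -opprD subrr.
- by rewrite !fliftD !fliftN fliftZ !flift_term phiZ subrr.
- by rewrite flift_term (phi_alt ij).
- by rewrite -(scale0r (0 : fmod A tuples)) fliftZ mul0r.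
- by rewrite fliftD rR sR addr0.
- by rewrite fliftZ rR mulr0.
Qed.

(** The universal property of the exterior power: the linear form induced by [phi]. It is computed
    on the chosen representative, which is harmless because [flift] kills the relations. *)
Definition ext_lift (w : extpow P k) : A :=
  \sum_(x <- fsupp (ext_repr w)) fcoef (ext_repr w) x * phi x.

Let ext_lift_pi r : ext_lift (ext_pi r) = flift r.
Proof.
apply/eqP; rewrite -subr_eq0 -[ext_lift _]/(flift _) -fliftN -fliftD.
by apply/eqP/flift_rel/ext_piP; rewrite ext_reprK.
Qed.

Lemma ext_lift_wedge x : ext_lift (wedge x) = phi x.
Proof. by rewrite ext_lift_pi flift_term. Qed.

Lemma ext_liftD v w : ext_lift (v + w) = ext_lift v + ext_lift w.
Proof. by rewrite -(ext_reprK v) -(ext_reprK w) -ext_piD !ext_lift_pi fliftD. Qed.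

Lemma ext_liftZ a w : ext_lift (a *: w) = a * ext_lift w.
Proof. by rewrite -(ext_reprK w) -ext_piZ !ext_lift_pi fliftZ. Qed.

End Lift.

Section Det.
Variable eta : 'I_k -> P -> A.
Hypothesis etaD : forall j u v, eta j (u + v) = eta j u + eta j v.
Hypothesis etaZ : forall j a u, eta j (a *: u) = a * eta j u.

(** The exterior product of the linear forms [eta j], as an alternating form. *)
Definition det_form (x : tuples) : A := \det (\matrix_(i, j) eta j (x i)).

Lemma det_formD x i u v :
  det_form (tset x i (u + v)) = det_form (tset x i u) + det_form (tset x i v).
Proof.
rewrite -[det_form (tset x i u)]mul1r -[det_form (tset x i v)]mul1r.
apply: (determinant_multilinear (i0 := i)); apply/matrixP => a b; rewrite !mxE !ffunE.
- by rewrite eqxx !mul1r etaD.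
- by rewrite eq_sym (negPf (neq_lift _ _)).
- by rewrite eq_sym (negPf (neq_lift _ _)).
Qed.

Lemma det_formZ x i a u : det_form (tset x i (a *: u)) = a * det_form (tset x i u).
Proof.
rewrite -[RHS]addr0 -[0 in RHS](mul0r (det_form (tset x i u))).
apply: (determinant_multilinear (i0 := i)); apply/matrixP => b c; rewrite !mxE !ffunE //.
- by rewrite eqxx mul0r addr0 etaZ.
- by rewrite eq_sym (negPf (neq_lift _ _)).
- by rewrite eq_sym (negPf (neq_lift _ _)).
Qed.

Lemma det_form_alt (x : tuples) i j : i != j -> x i = x j -> det_form x = 0.
Proof. by move=> ij xij; apply: (determinant_alternate ij) => l; rewrite !mxE xij. Qed.

End Det.

End ExteriorBasis.

Lemma wedge_scale (A : comNzRingType) (P : lmodType A) k (a : 'I_k -> A) (x : {ffun 'I_k -> P}) :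
  wedge [ffun i => a i *: x i] = (\prod_i a i) *: wedge x.
Proof.
pose y m : {ffun 'I_k -> P} := [ffun i : 'I_k => if (i < m)%N then a i *: x i else x i].
suff E m : (m <= k)%N -> wedge (y m) = (\prod_(i < k | (i < m)%N) a i) *: wedge x.
  have := E k (leqnn k).
  have -> : y k = [ffun i => a i *: x i] by apply/ffunP => i; rewrite !ffunE ltn_ord.
  by move=> ->; congr (_ *: _); apply: eq_bigl => i; rewrite ltn_ord.
elim: m => [_|m IH mk].
  by rewrite big_pred0 // scale1r; congr wedge; apply/ffunP => i; rewrite !ffunE.
pose i := Ordinal mk; rewrite (bigD1 i) /= ?ltnSn // -scalerA.
have -> : \prod_(l < k | (l < m.+1)%N && (l != i)) a l = \prod_(l < k | (l < m)%N) a l.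
  by apply: eq_bigl => l; rewrite ltnS [RHS]ltn_neqAle andbC.
rewrite -(IH (ltnW mk)) -(tset_id (y m) i) -wedge_tsetZ; congr wedge.
apply/ffunP => l; rewrite !ffunE.
case: (eqVneq l i) => [->|li]; first by rewrite ltnSn ltnn.
by rewrite ltnS leq_eqVlt (negPf (_ : val l != m)).
Qed.

(** Serves to compare composites of restrictions and of the torus action: once both sides are
    semilinear over the same ring map, only decomposable elements need checking. *)
Lemma ext_map_ind (A A' : comNzRingType) (P : lmodType A) (P' : lmodType A') k
    (rho : A -> A') (F F' : extpow P k -> extpow P' k) :
  (forall v w, F (v + w) = F v + F w) -> (forall a w, F (a *: w) = rho a *: F w) ->
  (forall v w, F' (v + w) = F' v + F' w) -> (forall a w, F' (a *: w) = rho a *: F' w) ->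
  (forall x, F (wedge x) = F' (wedge x)) -> F =1 F'.
Proof.
move=> FD FZ F'D F'Z Fx; apply: ext_ind => // [|v w vE wE|a w wE].
- have F0 (H : extpow P k -> extpow P' k) : (forall v w, H (v + w) = H v + H w) -> H 0 = 0.
    by move=> HD; apply: (addrI (H 0)); rewrite -HD !addr0.
  by rewrite !F0.
- by rewrite FD F'D vE wE.
- by rewrite FZ F'Z wE.
Qed.

(** * Derivations of monoid algebras *)

Section GroupAlgebraMore.
Variables (K : comNzRingType) (M : zmodType).
Implicit Types (f g : grpalg K M) (a m : M).

Lemma gexpD a b : gexp (a + b) = gexp a * gexp b :> grpalg K M.
Proof. by rewrite /gexp gtermM mulr1. Qed.

Lemma gexp0 : gexp 0 = 1 :> grpalg K M. Proof. by []. Qed.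

Lemma gexpNK a : gexp (- a) * gexp a = 1 :> grpalg K M.
Proof. by rewrite -gexpD addNr. Qed.

Lemma grpalgE f : f = \sum_(a <- fsupp f) fcoef f a *: gexp a.
Proof.
rewrite {1}(fmodE f); apply: eq_bigr => a _.
by rewrite /gexp ftermZ mulr1.
Qed.

Lemma fcoef_gexpM a f m : fcoef (gexp a * f) m = fcoef f (m - a).
Proof.
rewrite [f in LHS]grpalgE [f in RHS]grpalgE mulr_sumr !fcoef_sum.
apply: eq_bigr => b _; rewrite -scalerAr -gexpD !fcoefZ !fcoef_term.
by rewrite subr_eq addrC.
Qed.

Lemma fcoefMw (D : {fset M}) f g m : (fsupp f `<=` D)%fset ->
  fcoef (f * g) m = \sum_(a <- D) fcoef f a * fcoef g (m - a).
Proof.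
move=> fD; transitivity (\sum_(a <- fsupp f) fcoef f a * fcoef g (m - a)).
  rewrite [f in LHS]grpalgE mulr_suml fcoef_sum.
  by apply: eq_bigr => a _; rewrite -scalerAl fcoefZ fcoef_gexpM.
by apply: big_fset_incl => // a _ /fcoef_out->; rewrite mul0r.
Qed.

End GroupAlgebraMore.

(** * Invariant derivations of the group algebra *)

Section LogDerivation.
Variables (K : fieldType) (n : nat).
Local Notation G := (grpalg K (latM n)).
Implicit Types (v : 'cV[K]_n) (f g : G) (m : latM n).

(* The T-invariant vector field defined by v in N (x) K. *)
Definition logd v f : G := fmk (fsupp f) (fun m => pairing (extM K m) v * fcoef f m).

Lemma logdE v f m : fcoef (logd v f) m = pairing (extM K m) v * fcoef f m.
Proof. by rewrite fmkE; case: ifPn => // /fcoef_out->; rewrite mulr0. Qed.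

Lemma pairing_extMD m m' v :
  pairing (extM K (m + m')) v = pairing (extM K m) v + pairing (extM K m') v.
Proof. by rewrite /pairing /extM raddfD mulmxDl mxE. Qed.

Lemma logd_der v : is_der (logd v : G -> G).
Proof.
split=> [c f g|f g]; apply/fmodP => m.
  by rewrite fcoefD fcoefZ !logdE fcoefD fcoefZ mulrDr mulrCA.
have lf : (fsupp (logd v f) `<=` fsupp f)%fset.
  apply/fsubsetP => a; rewrite -!fcoef_neq0 logdE.
  by apply: contraNneq => ->; rewrite mulr0.
rewrite logdE fcoefD [g * _]mulrC !(@fcoefMw _ _ (fsupp f)) //.
rewrite mulr_sumr -big_split; apply: eq_bigr => a _ /=.
rewrite !logdE -{1}(subrK a m) pairing_extMD; ring.
Qed.

Lemma logdD v w f : logd (v + w) f = logd v f + logd w f.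
Proof. by apply/fmodP => m; rewrite fcoefD !logdE /pairing mulmxDr mxE mulrDl. Qed.

Lemma logdZ c v f : logd (c *: v) f = c *: logd v f.
Proof. by apply/fmodP => m; rewrite fcoefZ !logdE /pairing -scalemxAr mxE mulrA. Qed.

Lemma logd_gexp v m : logd v (gexp m) = pairing (extM K m) v *: gexp m.
Proof.
apply/fmodP => a; rewrite logdE fcoefZ fcoef_term.
by case: (eqVneq a m) => [->|]; rewrite ?mulr0.
Qed.

Lemma pairing_ext m (u : latN n) :
  pairing (extM K m) (extN K u) = (pairing m u)%:~R.
Proof. by rewrite /pairing /extM /extN -map_mxM mxE. Qed.

End LogDerivation.

Lemma pairing_col (L : comNzRingType) n (m : 'rV[L]_n) (B : 'M[L]_n) j :
  pairing m (col j B) = (m *m B) 0 j.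
Proof. by rewrite /pairing !mxE; apply: eq_bigr => i _; rewrite mxE. Qed.

Section MonoidDerivations.
Variables (K : fieldType) (n : nat) (S : addrClosed (latM n)).
Local Notation G := (grpalg K (latM n)).
Local Notation A := (monalg K S).
Implicit Types (m : latM n) (f g : A) (D E : der A).

Definition mkmon (g : G) : A := insubd 0 g.

Lemma mkmonE (g : G) : g \in supported_in S -> val (mkmon g) = g.
Proof. by move=> gS; rewrite /mkmon val_insubd gS. Qed.

Lemma monalg_supp f m : fcoef (val f) m != 0 -> m \in S.
Proof. by move: m; apply/supported_inP/valP. Qed.

Definition mono m : A := mkmon (gexp m).

Lemma monoE m : m \in S -> val (mono m) = gexp m.
Proof.
move=> mS; apply/mkmonE/supported_inP => a; rewrite fcoef_term.
by case: (eqVneq a m) => [->//|_]; rewrite eqxx.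
Qed.

Lemma monoD m m' : m \in S -> m' \in S -> mono (m + m') = mono m * mono m'.
Proof.
by move=> mS m'S; apply: val_inj; rewrite monalg_valM !monoE ?gexpD ?rpredD.
Qed.

Lemma val_monalg_sum (I : Type) (r : seq I) (P : pred I) (F : I -> A) :
  val (\sum_(i <- r | P i) F i) = \sum_(i <- r | P i) val (F i).
Proof. exact: (raddf_sum (val : A -> G)). Qed.

Lemma val_monalg1 : val (1 : A) = 1.
Proof. exact: (rmorph1 (val : A -> G)). Qed.

Lemma monalg_sum_mono f : f = \sum_(a <- fsupp (val f)) fcoef (val f) a *: mono a.
Proof.
apply: val_inj; rewrite val_monalg_sum [LHS]grpalgE big_seq [RHS]big_seq.
apply: eq_bigr => a; rewrite -fcoef_neq0 => /monalg_supp aS.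
by rewrite monalg_valZ monoE.
Qed.

Lemma derDE D E f : (D + E) f = D f + E f. Proof. by []. Qed.

Lemma derZE (a : A) D f : (a *: D) f = a * D f. Proof. by []. Qed.

Lemma der0E f : (0 : der A) f = 0. Proof. by []. Qed.

Lemma der_sumE (I : Type) (r : seq I) (P : pred I) (F : I -> der A) f :
  (\sum_(i <- r | P i) F i) f = \sum_(i <- r | P i) F i f.
Proof. exact: (big_morph (fun D : der A => D f : A) (fun D E => derDE D E f) (der0E f)). Qed.

Lemma der_linear D c f g : D (c *: f + g) = c *: D f + D g.
Proof. by have [+ _] := derP D; apply. Qed.

Lemma derM D f g : D (f * g) = f * D g + g * D f.
Proof. by have [_] := derP D; apply. Qed.

Lemma der_add D f g : D (f + g) = D f + D g.
Proof. by rewrite -[f]scale1r der_linear !scale1r. Qed.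

Lemma der_zero D : D 0 = 0.
Proof. by apply: (addrI (D 0)); rewrite -der_add !addr0. Qed.

Lemma der_scale D c f : D (c *: f) = c *: D f.
Proof. by rewrite -[c *: f]addr0 der_linear der_zero addr0. Qed.

Lemma der_sum D (I : Type) (r : seq I) (P : pred I) (F : I -> A) :
  D (\sum_(i <- r | P i) F i) = \sum_(i <- r | P i) (D (F i) : A).
Proof. exact: (big_morph (fun f => D f : A) (der_add D) (der_zero D)). Qed.

Definition mkder_fun (d : G -> G) (f : A) : A^o := mkmon (d (val f)).

Lemma mkder_subproof (d : G -> G) : is_der d ->
  (forall f, d (val f) \in supported_in S) -> mkder_fun d \in @der_pred K A.
Proof.
move=> [d1 d2] dS; apply/asboolP; have dE f : val (mkder_fun d f) = d (val f) by exact: mkmonE.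
split=> [c f g|f g]; apply: val_inj; rewrite dE.
  by rewrite monalg_valD monalg_valZ d1 monalg_valD monalg_valZ !dE.
by rewrite monalg_valM d2 monalg_valD !monalg_valM !dE.
Qed.

Definition mkder (d : G -> G) (dd : is_der d)
  (dS : forall f, d (val f) \in supported_in S) : der A :=
  MkDer (mkder_subproof dd dS).

Lemma mkderE d (dd : is_der d) dS f : val (mkder dd dS f) = d (val f).
Proof. exact: mkmonE. Qed.

(** The logarithmic derivative of chi^m along [D], taken in the full group algebra, where chi^m is
    invertible; the Leibniz rule makes it additive in m on [S]. *)
Definition ell D m : G := gexp (- m) * val (D (mono m)).

Lemma ellK D m : val (D (mono m)) = gexp m * ell D m.
Proof. by rewrite /ell mulrA -gexpD subrr mul1r. Qed.

Lemma ellD D m m' : m \in S -> m' \in S -> ell D (m + m') = ell D m + ell D m'.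
Proof.
move=> mS m'S; rewrite {1}/ell monoD // derM monalg_valD !monalg_valM !monoE //.
rewrite !ellK opprD gexpD.
transitivity ((gexp (- m) * gexp m) * (gexp (- m') * gexp m') * (ell D m + ell D m')).
  ring.
by rewrite !gexpNK !mul1r.
Qed.

Lemma ell0 D : ell D 0 = 0.
Proof.
have S0 : 0 \in S by exact: rpred0.
by apply: (addrI (ell D 0)); rewrite -ellD ?addr0.
Qed.

Lemma ellMn D m c : m \in S -> ell D (m *+ c) = ell D m *+ c.
Proof.
move=> mS; elim: c => [|c IH]; first by rewrite ell0.
by rewrite !mulrS ellD ?IH ?rpredMn.
Qed.

Lemma ell_sum D (I : Type) (r : seq I) (F : I -> latM n) :
  (forall i, F i \in S) -> ell D (\sum_(i <- r) F i) = \sum_(i <- r) ell D (F i).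
Proof.
move=> FS; elim: r => [|i r IH]; first by rewrite !big_nil ell0.
by rewrite !big_cons ellD ?IH ?rpred_sum.
Qed.

End MonoidDerivations.

(* S is the set of lattice points of the dual of the cone generated by the
   columns of B with index in J; the rows of B' form the dual basis. *)
Definition smooth_monoid n (S : addrClosed (latM n)) (B B' : 'M[int]_n) (J : {set 'I_n}) :=
  B' *m B = 1%:M /\ forall m, (m \in S) = [forall (j | j \in J), 0 <= (m *m B) 0 j].

(** * Derivations on the chart of a smooth cone *)

Section SmoothMonoid.
Variables (K : fieldType) (n : nat) (S : addrClosed (latM n)).
Variables (B B' : 'M[int]_n) (J : {set 'I_n}).
Hypothesis smS : smooth_monoid S B B' J.
Local Notation G := (grpalg K (latM n)).
Local Notation A := (monalg K S).
Implicit Types (m : latM n) (f g : A) (D E : der A).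

Lemma dual_basisE i j : (row i B' *m B) 0 j = (i == j)%:R.
Proof. by rewrite -row_mul smS.1 !mxE. Qed.

Lemma dual_basis_in i : row i B' \in S.
Proof. by rewrite smS.2; apply/forall_inP => j _; rewrite dual_basisE ler0n. Qed.

Lemma dual_basis_sum m : m = \sum_j row j B' *~ (m *m B) 0 j.
Proof.
rewrite -[LHS]mulmx1 -(mulmx1C smS.1) mulmxA.
rewrite [LHS]mulmx_sum_row; apply: eq_bigr => j _.
by rewrite -[in RHS]scaler_int intz.
Qed.

(** Additivity of [ell] is known only on [S], while the coordinates of m may be negative. Splitting
    them into positive and negative parts gives m + Q q = Q p with all three terms in [S]. *)
Lemma ell_dual_basis D m : m \in S ->
  ell D m = \sum_j ell D (row j B') *~ (m *m B) 0 j.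
Proof.
move=> mS; pose a j : int := (m *m B) 0 j.
pose p j : nat := if 0 <= a j then absz (a j) else 0%N.
pose q j : nat := if 0 <= a j then 0%N else absz (a j).
have apq j : a j = (p j)%:Z - (q j)%:Z.
  rewrite /p /q; case: ifPn => [a0|]; first by rewrite gez0_abs ?subr0.
  by rewrite -ltNge => a0; rewrite ltz0_abs // opprK add0r.
pose Q (c : 'I_n -> nat) := \sum_j row j B' *+ c j.
have QS c : Q c \in S by apply: rpred_sum => j _; exact/rpredMn/dual_basis_in.
have ellQ c : ell D (Q c) = \sum_j ell D (row j B') *+ c j.
  rewrite ell_sum => [|j]; last exact/rpredMn/dual_basis_in.
  by apply: eq_bigr => j _; rewrite ellMn ?dual_basis_in.
have mQ : m + Q q = Q p.
  rewrite {1}(dual_basis_sum m) -big_split; apply: eq_bigr => j _ /=.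
  by rewrite -/(a j) apq mulrzBr !pmulrn subrK.
apply: (addIr (ell D (Q q))); rewrite -ellD // mQ !ellQ -big_split.
by apply: eq_bigr => j _ /=; rewrite -/(a j) apq mulrzBr !pmulrn subrK.
Qed.

(** By linearity it suffices to look at chi^m, where both sides are chi^m times [ell D m], by
    [ell_dual_basis]. *)
Lemma der_valE D f :
  val (D f) = \sum_j ell D (row j B') * logd (extN K (col j B)) (val f).
Proof.
rewrite {1}(monalg_sum_mono f) der_sum val_monalg_sum.
transitivity (\sum_(m <- fsupp (val f)) \sum_j
    ell D (row j B') * (fcoef (val f) m *: logd (extN K (col j B)) (gexp m))).
  rewrite big_seq [RHS]big_seq; apply: eq_bigr => m.
  rewrite -fcoef_neq0 => /monalg_supp mS.
  rewrite der_scale monalg_valZ ellK ell_dual_basis // mulr_sumr scaler_sumr.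
  apply: eq_bigr => j _; rewrite logd_gexp pairing_ext pairing_col.
  rewrite -scalerAr; congr (_ *: _).
  by rewrite scaler_int !mulrzAr mulrC.
rewrite exchange_big; apply: eq_bigr => j _; rewrite -mulr_sumr; congr (_ * _).
have [l1 _] := logd_der (extN K (col j B)).
set l := logd _ in l1 *.
have lD (f1 g1 : G) : l (f1 + g1) = l f1 + l g1 by rewrite -{1}[f1]scale1r l1 scale1r.
have l0 : l 0 = 0 by apply: (addrI (l 0)); rewrite -lD !addr0.
rewrite [in RHS](grpalgE (val f)) (big_morph l lD l0).
have lZ c (g1 : G) : l (c *: g1) = c *: l g1.
  by rewrite -[c *: g1]addr0 l1 l0 addr0.
by apply: eq_bigr => m _; rewrite lZ.
Qed.

Lemma der_eq D E : (forall j, D (mono _ S (row j B')) = E (mono _ S (row j B'))) -> D = E.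
Proof.
move=> DE; apply/val_inj/funext => f; apply: val_inj; rewrite /= !der_valE.
by apply: eq_bigr => j _; rewrite /ell DE.
Qed.

Definition pole j : latM n := if j \in J then row j B' else 0.

(** Division by chi^(b*_j) stays in the chart: the factor <m, b_j> brought by [logd] kills the
    exponents whose j-th coordinate is 0, so those that remain have j-th coordinate at least 1. *)
Lemma bder_subproof j f :
  gexp (- pole j) * logd (extN K (col j B)) (val f) \in supported_in S.
Proof.
apply/supported_inP => m; rewrite fcoef_gexpM opprK logdE pairing_ext.
rewrite pairing_col mulf_eq0 negb_or /pole => /andP[m0 /monalg_supp].
rewrite !smS.2 => /forall_inP mS; apply/forall_inP => i iJ.
have := mS i iJ; move: m0; case: ifP => jJ; last by rewrite addr0.
rewrite mulmxDl mxE [(m *m B + _) 0 i]mxE !dual_basisE.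
case: (eqVneq j i) => [->|_]; last by rewrite addr0.
rewrite eqxx; case: (_ 0 i) => [//|[|c]] //.
by rewrite (_ : _ + _ = 0 :> int) ?eqxx.
Qed.

Lemma bder_der j : is_der (fun f : G => gexp (- pole j) * logd (extN K (col j B)) f).
Proof.
have [l1 l2] := logd_der (extN K (col j B)).
by split=> [c f g|f g]; rewrite (l1, l2); [rewrite mulrDr -scalerAr | ring].
Qed.

Definition bder j : der A := mkder (bder_der j) (@bder_subproof j).

(** The coordinate of [D] on [bder j]. The monoid [S1] of [D] may differ from [S], so that one
    formula serves both to expand a derivation and to extend it to a larger chart. *)
Definition bcoord (S1 : addrClosed (latM n)) (D : der (monalg K S1)) j : A :=
  mkmon S (gexp (pole j) * ell D (row j B')).

End SmoothMonoid.

(** * Extension of derivations to a larger chart *)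

Section Inclusion.
Variables (K : fieldType) (n : nat) (S S' : addrClosed (latM n)).
Hypothesis SS' : {subset S <= S'}.
Local Notation A := (monalg K S).
Local Notation A' := (monalg K S').
Local Notation incl := (@monalg_incl K (latM n) S S').
Implicit Types (f g : A) (D E : der A).

Lemma supported_sub (f : grpalg K (latM n)) :
  f \in supported_in S -> f \in supported_in S'.
Proof. by move=> /supported_inP fS; apply/supported_inP => m /fS/SS'. Qed.

Lemma inclE f : val (incl f) = val f.
Proof. exact/mkmonE/supported_sub/valP. Qed.

Lemma incl1 : incl 1 = 1.
Proof. by apply: val_inj; rewrite inclE !val_monalg1. Qed.

Lemma inclD : {morph incl : f g / f + g}.
Proof. by move=> f g; apply: val_inj; rewrite monalg_valD !inclE monalg_valD. Qed.

Lemma inclM : {morph incl : f g / f * g}.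
Proof. by move=> f g; apply: val_inj; rewrite monalg_valM !inclE monalg_valM. Qed.

Lemma inclZ c f : incl (c *: f) = c *: incl f.
Proof. by apply: val_inj; rewrite monalg_valZ !inclE monalg_valZ. Qed.

Lemma incl_mono m : m \in S -> incl (mono K S m) = mono K S' m.
Proof. by move=> mS; apply: val_inj; rewrite inclE !monoE // SS'. Qed.

(* This is restr_der when S and S' are the dual monoids of sigma and tau. *)
Definition rder D : der A' :=
  xget 0 [set D' : der A' | forall f, D' (incl f) = incl (D f)].

Variables (B B' : 'M[int]_n) (J J' : {set 'I_n}).
Hypotheses (smS : smooth_monoid S B B' J) (smS' : smooth_monoid S' B B' J').

(** For j in [J'] the two powers cancel and D(chi^(b*_j)) is left; for the other j the shift by
    -b*_j does not affect the coordinates indexed by [J']. *)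
Lemma bcoord_supp D j :
  gexp (pole B' J' j) * ell D (row j B') \in supported_in S'.
Proof.
have DS := supported_sub (valP (D (mono K S (row j B')))).
rewrite /ell /pole mulrA -gexpD; case: ifP => jJ; first by rewrite subrr mul1r.
rewrite add0r; apply/supported_inP => m; rewrite fcoef_gexpM opprK.
move/supported_inP: DS => DS /DS; rewrite !smS'.2 => /forall_inP mS.
apply/forall_inP => i iJ; move: (mS i iJ).
rewrite mulmxDl mxE (dual_basisE smS); case: (eqVneq j i) => [ji|_]; last by rewrite addr0.
by rewrite ji iJ in jJ.
Qed.

Lemma bcoordE D j : val (bcoord S' B' J' D j) = gexp (pole B' J' j) * ell D (row j B').
Proof. exact/mkmonE/bcoord_supp. Qed.

(** The extension is the combination of the basis fields of the larger chart with the coordinates of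
    [D]. *)
Lemma rder_ex D : exists D' : der A', forall f, D' (incl f) = incl (D f).
Proof.
exists (\sum_j bcoord S' B' J' D j *: bder K smS' j) => f.
apply: val_inj; rewrite der_sumE inclE (der_valE smS) val_monalg_sum.
apply: eq_bigr => j _; rewrite derZE monalg_valM bcoordE mkderE inclE.
by rewrite mulrACA -gexpD subrr mul1r.
Qed.

Lemma rderP D f : rder D (incl f) = incl (D f).
Proof.
have [D' D'P] := rder_ex D; rewrite /rder.
by case: xgetP => [? _ ->//|/(_ D')]; case.
Qed.

(** The monomials of the dual basis already lie in [S] and determine a derivation on [S']. Linearity
    and functoriality of [rder] are deduced from this uniqueness. *)
Lemma rder_uniq D (D' : der A') : (forall f, D' (incl f) = incl (D f)) -> rder D = D'.
Proof.
move=> D'P; apply: (der_eq smS') => j.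
by rewrite -incl_mono ?rderP ?D'P // (dual_basis_in smS).
Qed.

Lemma rderD : {morph rder : D E / D + E}.
Proof. by move=> D E; apply: rder_uniq => f; rewrite derDE !rderP -inclD. Qed.

Lemma rderZ (a : A) D : rder (a *: D) = incl a *: rder D.
Proof. by apply: rder_uniq => f; rewrite derZE rderP -inclM. Qed.

End Inclusion.

Section Expansion.
Variables (K : fieldType) (n : nat) (S : addrClosed (latM n)).
Variables (B B' : 'M[int]_n) (J : {set 'I_n}).
Hypothesis smS : smooth_monoid S B B' J.

Lemma bder_expand (D : der (monalg K S)) :
  D = \sum_j bcoord S B' J D j *: bder K smS j.
Proof.
apply/val_inj/funext => f; apply: val_inj.
rewrite /= der_sumE (der_valE smS) val_monalg_sum.
apply: eq_bigr => j _; rewrite derZE monalg_valM (bcoordE (fun=> id) smS) // mkderE.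
by rewrite mulrACA -gexpD subrr mul1r.
Qed.

End Expansion.

(** * Vector fields and invariant 1-forms on the torus *)

Section TorusFields.
Variables (K : fieldType) (n : nat) (S0 : addrClosed (latM n)).
Hypothesis S0T : forall m, m \in S0.
Local Notation G := (grpalg K (latM n)).
Local Notation A0 := (monalg K S0).
Implicit Types (m : latM n) (f g : A0) (D E : der A0) (v : 'cV[K]_n) (u : 'rV[K]_n).

Lemma supported_all (f : G) : f \in supported_in S0.
Proof. exact/supported_inP. Qed.

(** The torus is the smooth chart with no generators, for every choice of basis; it can therefore be
    compared with any chart in the basis of that chart. *)
Lemma smooth_all (B B' : 'M[int]_n) : B' *m B = 1%:M -> smooth_monoid S0 B B' finset.set0.
Proof.
move=> B'B; split=> // m; rewrite S0T; apply/esym/forall_inP => j.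
by rewrite inE.
Qed.

Definition dv v : der A0 := mkder (logd_der v) (fun f => supported_all (logd v (val f))).

Lemma dvE v f : val (dv v f) = logd v (val f). Proof. exact: mkderE. Qed.

Lemma dvD v w : dv (v + w) = dv v + dv w.
Proof.
apply/val_inj/funext => f; apply: val_inj.
by rewrite -[RHS]/(val (dv v f + dv w f)) monalg_valD !dvE logdD.
Qed.

Lemma dvZ c v : dv (c *: v) = c%:A *: dv v.
Proof.
apply/val_inj/funext => f; apply: val_inj.
by rewrite -[RHS]/(val (c%:A * dv v f)) mulr_algl monalg_valZ !dvE logdZ.
Qed.

(** The contraction of [D] with the invariant 1-form sum_l u_l dx_l / x_l, where x_l is the l-th
    coordinate function of the torus. *)
Definition eta u D : A0 :=
  \sum_l u 0 l *: (mono K S0 (- delta_mx 0 l) * D (mono K S0 (delta_mx 0 l))).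

Lemma etaD u D E : eta u (D + E) = eta u D + eta u E.
Proof.
rewrite /eta -big_split; apply: eq_bigr => l _.
by rewrite derDE mulrDr scalerDr.
Qed.

Lemma etaZ u f D : eta u (f *: D) = f * eta u D.
Proof.
rewrite /eta mulr_sumr; apply: eq_bigr => l _.
by rewrite derZE -scalerAr mulrCA.
Qed.

Lemma eta_dv u v : eta u (dv v) = (pairing u v)%:A.
Proof.
rewrite /eta /pairing mxE scaler_suml; apply: eq_bigr => l _.
rewrite -scalerA; congr (_ *: _); apply: val_inj.
rewrite monalg_valM monoE // dvE monoE // logd_gexp -scalerAr gexpNK monalg_valZ.
rewrite val_monalg1; congr (_ *: _); rewrite /pairing mxE (bigD1 l) //= !mxE !eqxx mul1r.
by rewrite big1 ?addr0 // => i /negPf il; rewrite !mxE eq_sym eqxx eq_sym il mul0r.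
Qed.

Lemma dv_sum (I : Type) (r : seq I) (F : I -> 'cV[K]_n) :
  dv (\sum_(i <- r) F i) = \sum_(i <- r) dv (F i).
Proof.
apply: (big_morph dv dvD); rewrite -(scale0r (0 : 'cV_n)) dvZ.
by rewrite scale0r scale0r.
Qed.

Lemma dv_expand0 D : D = \sum_l eta (delta_mx 0 l) D *: dv (delta_mx l 0).
Proof.
have sm := smooth_all (mul1mx (1%:M : 'M[int]_n)).
apply/val_inj/funext => f; apply: val_inj.
rewrite /= der_sumE (der_valE sm) val_monalg_sum; apply: eq_bigr => l _.
rewrite derZE monalg_valM dvE; congr (_ * logd _ _).
  rewrite /eta (bigD1 l) //= mxE !eqxx scale1r big1 ?addr0 => [|i /negPf il].
    by rewrite /ell row1 -(monoE K (S0T (- _))).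
  by rewrite mxE il andbF scale0r.
by apply/matrixP => i j; rewrite !mxE ord1 eqxx andbT; case: (i == l).
Qed.

Lemma eta_row (C : 'M[K]_n) j D :
  eta (row j C) D = \sum_l C j l *: eta (delta_mx 0 l) D.
Proof.
rewrite /eta; apply: eq_bigr => l _; rewrite mxE; congr (_ *: _).
rewrite (bigD1 l) //= mxE !eqxx scale1r big1 ?addr0 // => i /negPf il.
by rewrite mxE il andbF scale0r.
Qed.

(** The matrix [C] has entries in the field, whereas [der_valE] concerns integral bases; the
    expansion in the standard basis is carried over to [C] through C C' = 1. *)
Lemma dv_expand (C C' : 'M[K]_n) D : C' *m C = 1%:M ->
  D = \sum_j eta (row j C') D *: dv (col j C).
Proof.
move=> /mulmx1C CC'; have dv_col j : dv (col j C) = \sum_l (C l j)%:A *: dv (delta_mx l 0).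
  rewrite [X in dv X]matrix_sum_delta dv_sum; apply: eq_bigr => l _.
  by rewrite big_ord1 dvZ mxE.
have scal2 (a b : K) (x : A0) E : (a *: x) *: (b%:A *: E) = (b * a)%:A *: (x *: E).
  by rewrite !scalerA; congr (_ *: _); rewrite mulr_algr mulr_algl scalerA.
under eq_bigr do rewrite eta_row dv_col scaler_suml.
rewrite exchange_big [LHS]dv_expand0; apply: eq_bigr => l _ /=.
under eq_bigr do rewrite scaler_sumr.
rewrite exchange_big /=; move: (eta (delta_mx 0 l) D) => e.
rewrite (bigD1 l) //= [X in _ = _ + X]big1 => [|i il].
  rewrite addr0; transitivity (((C *m C') l l)%:A *: (e *: dv (delta_mx l 0))).
    by rewrite CC' mxE eqxx !scale1r.
  rewrite mxE !scaler_suml; apply: eq_bigr => j _.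
  exact/esym/scal2.
transitivity (((C *m C') i l)%:A *: (e *: dv (delta_mx i 0))).
  rewrite mxE !scaler_suml; apply: eq_bigr => j _.
  exact: scal2.
by rewrite CC' mxE (negPf il) !scale0r.
Qed.

End TorusFields.

(** * Coordinates of polyvector fields on the torus *)

Section Plucker.
Variables (K : fieldType) (n k : nat) (kn : (k <= n)%N) (S0 : addrClosed (latM n)).
Hypothesis S0T : forall m, m \in S0.
Local Notation A0 := (monalg K S0).
Local Notation T0 := (extpow (der A0) k).
Local Notation enumI := (enumI kn).
Implicit Types (w : T0) (xi : 'M[K]_(k, n)) (I : {set 'I_n}) (m : latM n) (C : 'M[K]_n).

Definition dvI C I : T0 := wedgeI kn (fun j => dv S0T (col j C)) I.

(* The value of the polyvector field w on the k-tuple of invariant 1-forms given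
   by the rows of xi. *)
Definition pl xi w : A0 := ext_lift (det_form (fun j => eta (row j xi))) w.

Lemma plD xi v w : pl xi (v + w) = pl xi v + pl xi w.
Proof.
apply: ext_liftD.
- by move=> *; apply: det_formD => *; apply: etaD.
- by move=> *; apply: det_formZ => *; apply: etaZ.
- by move=> x i j; apply: det_form_alt.
Qed.

Lemma plZ xi a w : pl xi (a *: w) = a * pl xi w.
Proof.
apply: ext_liftZ.
- by move=> *; apply: det_formD => *; apply: etaD.
- by move=> *; apply: det_formZ => *; apply: etaZ.
- by move=> x i j; apply: det_form_alt.
Qed.

Lemma pl0 xi : pl xi 0 = 0.
Proof. by rewrite -(scale0r (0 : T0)) plZ mul0r. Qed.

Lemma pl_sum xi (I : Type) (r : seq I) (P : pred I) (F : I -> T0) :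
  pl xi (\sum_(i <- r | P i) F i) = \sum_(i <- r | P i) pl xi (F i).
Proof. exact: (big_morph (pl xi) (plD xi) (pl0 xi)). Qed.

Lemma pl_dvI xi C I : pl xi (dvI C I) = (\det (xi *m colsub (enumI I) C))%:A.
Proof.
rewrite /pl ext_lift_wedge.
- rewrite /det_form -det_tr -[RHS]/(in_alg A0 _) -det_map_mx; congr (\det _).
  apply/matrixP => i j; rewrite !mxE ffunE eta_dv /pairing mxE /=.
  by congr (_ *: _); apply: eq_bigr => l _; rewrite !mxE.
- by move=> *; apply: det_formD => *; apply: etaD.
- by move=> *; apply: det_formZ => *; apply: etaZ.
- by move=> x i j; apply: det_form_alt.
Qed.

(** The product is a submatrix of the identity. If I' and I differ, having the same size they admit
    an index in I' outside I, which gives a zero row. *)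
Lemma det_dual C C' I I' : C' *m C = 1%:M -> #|I| = k -> #|I'| = k ->
  \det (rowsub (enumI I') C' *m colsub (enumI I) C) = (I' == I)%:R.
Proof.
move=> C'C cI cI'; rewrite -mxsub_mul C'C.
have [->|II'] := eqVneq I' I.
  have -> : mxsub (enumI I) (enumI I) 1%:M = 1%:M :> 'M[K]_k.
    by apply/matrixP => i j; rewrite !mxE (inj_eq (enumI_inj (kn := kn) cI)).
  by rewrite det1.
have [i iI' iI] : exists2 i, i \in I' & i \notin I.
  apply/subsetPn; apply: contraNN II' => sI'I.
  by rewrite eqEcard sI'I cI cI' leqnn.
have [j Ej] := enumI_onto kn cI' iI'.
rewrite (expand_det_row _ j) big1 // => l _; rewrite !mxE Ej.
case: eqP => [il|_]; last by rewrite mul0r.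
by move: iI; rewrite il enumI_in.
Qed.

Lemma pl_dual C C' I I' : C' *m C = 1%:M -> #|I| = k -> #|I'| = k ->
  pl (rowsub (enumI I') C') (dvI C I) = (I' == I)%:R.
Proof.
by move=> C'C cI cI'; rewrite pl_dvI (det_dual C'C) //; case: eqP; rewrite ?scale1r ?scale0r.
Qed.

(** Spanning provides some coefficients, and evaluation on the dual rows of [C'] identifies them. *)
Lemma pl_expand C C' w : C' *m C = 1%:M ->
  w = \sum_(I : {set 'I_n} | #|I| == k) pl (rowsub (enumI I) C') w *: dvI C I.
Proof.
move=> C'C.
have [a Ea] := wedgeI_span kn (fun D => dv_expand S0T D C'C) w.
rewrite {1}Ea; apply: eq_bigr => I /eqP cI; congr (_ *: _).
rewrite Ea pl_sum (bigD1 I) ?cI //= plZ (pl_dual C'C) // eqxx mulr1.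
rewrite big1 ?addr0 // => J /andP[/eqP cJ JI].
by rewrite plZ (pl_dual C'C) // eq_sym (negPf JI) mulr0.
Qed.

Definition plm xi m w : K := fcoef (val (pl xi w)) m.

Lemma plmZ xi m (c : K) w : plm xi m (c%:A *: w) = c * plm xi m w.
Proof. by rewrite /plm plZ mulr_algl monalg_valZ fcoefZ. Qed.

Lemma plm_sum xi m (I : Type) (r : seq I) (P : pred I) (F : I -> T0) :
  plm xi m (\sum_(i <- r | P i) F i) = \sum_(i <- r | P i) plm xi m (F i).
Proof. by rewrite /plm pl_sum val_monalg_sum fcoef_sum. Qed.

Lemma plm_eq v w : (forall xi m, plm xi m v = plm xi m w) -> v = w.
Proof.
move=> vw; rewrite (pl_expand v (mul1mx 1%:M)) (pl_expand w (mul1mx 1%:M)).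
apply: eq_bigr => I _.
suff -> : pl (rowsub (enumI I) 1%:M) v = pl (rowsub (enumI I) 1%:M) w by [].
apply: val_inj.
apply/fmodP => m.
exact: (vw (rowsub (enumI I) 1%:M) m).
Qed.

(* The polyvector field chi^m c_I, where c_I is the wedge product of the columns
   of C with index in I; the torus acts on it with weight -m. *)
Definition xdv m C I : T0 := mono K S0 m *: dvI C I.

Lemma plm_xdv xi m m' C I :
  plm xi m' (xdv m C I) = (m' == m)%:R * \det (xi *m colsub (enumI I) C).
Proof.
rewrite /plm plZ pl_dvI mulr_algr monalg_valZ fcoefZ monoE // fcoef_term mulrC.
by case: eqP.
Qed.

Lemma plm0 xi m : plm xi m 0 = 0.
Proof. by rewrite /plm pl0 raddf0 fcoef0. Qed.

Lemma plm_sum_xdv (P : finType) (c : P -> K) (mu : P -> latM n) (C : P -> 'M[K]_n)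
    (I : P -> {set 'I_n}) xi m :
  plm xi m (\sum_p (c p)%:A *: xdv (mu p) (C p) (I p)) =
  \sum_p c p * ((m == mu p)%:R * \det (xi *m colsub (enumI (I p)) (C p))).
Proof. by rewrite plm_sum; apply: eq_bigr => p _; rewrite plmZ plm_xdv. Qed.

(** The matrix [C p] is allowed to vary with [p] because the adapted basis depends on the weight;
    independence comes from a dual family of functionals [plm]. *)
Lemma xdv_free (P : finType) (c : P -> K) (mu : P -> latM n) (C : P -> 'M[K]_n)
    (I : P -> {set 'I_n}) (xi : P -> 'M[K]_(k, n)) :
  (forall p q, (mu p == mu q)%:R * \det (xi p *m colsub (enumI (I q)) (C q)) =
    (q == p)%:R :> K) ->
  \sum_p (c p)%:A *: xdv (mu p) (C p) (I p) = 0 -> forall p, c p = 0.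
Proof.
move=> dual /(congr1 (plm (xi _) (mu _))) E p; have := E p p.
rewrite plm_sum_xdv plm0 (bigD1 p) //= dual eqxx mulr1 big1 ?addr0 // => q /negPf qp.
by rewrite dual qp mulr0.
Qed.

(** The bridge between bases: the coordinates of weight m in one basis determine the value on every
    [xi], hence the coordinates in any other basis. *)
Lemma plm_expand C C' xi m w : C' *m C = 1%:M ->
  plm xi m w = \sum_(I : {set 'I_n} | #|I| == k)
     plm (rowsub (enumI I) C') m w * \det (xi *m colsub (enumI I) C).
Proof.
move=> C'C; rewrite {1}(pl_expand w C'C) plm_sum; apply: eq_bigr => I _.
by rewrite /plm plZ pl_dvI mulr_algr monalg_valZ fcoefZ mulrC.
Qed.

Lemma plm_expand_neq0 C C' xi m w : C' *m C = 1%:M -> plm xi m w != 0 ->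
  exists I, [/\ #|I| = k, plm (rowsub (enumI I) C') m w != 0 &
                \det (xi *m colsub (enumI I) C) != 0].
Proof.
move=> C'C; rewrite (plm_expand _ _ _ C'C) => w0.
have /existsP[I /andP[/eqP cI]] :
    [exists I : {set 'I_n}, (#|I| == k) && (plm (rowsub (enumI I) C') m w *
        \det (xi *m colsub (enumI I) C) != 0)].
  apply: contraNT w0; rewrite negb_exists => /forallP w0.
  rewrite big1 // => I cI; have := w0 I; rewrite cI /= negbK => /eqP //.
by rewrite mulf_eq0 negb_or => /andP[w1 w2]; exists I.
Qed.

(* A decomposable multivector containing v vanishes on tuples of forms killing v. *)
Lemma det_vanish C xi I (v : 'cV[K]_n) (a : 'I_n -> K) : #|I| = k ->
  v != 0 -> v = \sum_(j in I) a j *: col j C ->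
  \det (xi *m colsub (enumI I) C) != 0 -> exists i, pairing (row i xi) v != 0.
Proof.
move=> cI v0 Ev d0; apply/existsP; apply: contraNT d0.
rewrite negb_exists => /forallP xiv; rewrite -det_tr; apply/det0P.
have EvI : v = \sum_j a (enumI I j) *: col (enumI I j) C.
  have inj := enumI_inj (kn := kn) cI.
  rewrite Ev -(big_imset (fun j => a j *: col j C) (in2W inj)) /=.
  apply: eq_bigl => j; apply/idP/imsetP => [/(enumI_onto kn cI)[i <-]|[i _ ->]].
    by exists i.
  exact: enumI_in.
(* If every row of [xi] kills [v], the coefficients of [v] on the columns in [I] form a nonzero
   kernel vector. *)
exists (\row_j a (enumI I j)).
  apply: contraNneq v0 => a0; rewrite EvI big1 // => j _.
  by move/rowP/(_ j): a0; rewrite !mxE => ->; rewrite scale0r.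
apply/rowP => i; rewrite mxE.
have := xiv i; rewrite negbK EvI /pairing => /eqP.
rewrite mxE => E; rewrite [RHS]mxE -[RHS]E; under [RHS]eq_bigr do rewrite summxE mulr_sumr.
rewrite exchange_big; apply: eq_bigr => j _ /=.
rewrite !mxE mulr_sumr; apply: eq_bigr => l _; rewrite !mxE; ring.
Qed.

End Plucker.

(** * Restriction to the torus *)

Section Restriction.
Variables (K : fieldType) (n k : nat) (kn : (k <= n)%N).
Variables (S S0 : addrClosed (latM n)).
Hypothesis S0T : forall m, m \in S0.
Variables (B B' : 'M[int]_n) (J : {set 'I_n}).
Hypothesis smS : smooth_monoid S B B' J.
Local Notation A := (monalg K S).
Local Notation A0 := (monalg K S0).
Local Notation enumI := (enumI kn).
Local Notation C := (map_mx intr B : 'M[K]_n).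
Local Notation C' := (map_mx intr B' : 'M[K]_n).
Implicit Types (w : extpow (der A) k) (I : {set 'I_n}) (m : latM n).

Let SS0 : {subset S <= S0}. Proof. by move=> m _; exact: S0T. Qed.
Let smS0 := smooth_all S0T smS.1.

Lemma dual_basis_map : C' *m C = 1%:M.
Proof. by rewrite -map_mxM smS.1 map_mx1. Qed.

Definition ext_restr (S1 S2 : addrClosed (latM n)) (w : extpow (der (monalg K S1)) k) :
  extpow (der (monalg K S2)) k := ext_map (@monalg_incl K _ S1 S2) (@rder K n S1 S2) w.
Local Notation res := (@ext_restr S S0).

Lemma ext_restrD v w : res (v + w) = res v + res w.
Proof.
apply: ext_mapD; [exact: incl1|exact: inclD|exact: inclM| |].
  exact: (rderD SS0 smS smS0).
exact: (rderZ SS0 smS smS0).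
Qed.

Lemma ext_restrZ a w : res (a *: w) = monalg_incl S0 a *: res w.
Proof.
apply: ext_mapZ; [exact: incl1|exact: inclD|exact: inclM| |].
  exact: (rderD SS0 smS smS0).
exact: (rderZ SS0 smS smS0).
Qed.

Lemma ext_restr_wedge x : res (wedge x) = wedge [ffun i => rder S0 (x i)].
Proof.
apply: ext_map_wedge; [exact: incl1|exact: inclD|exact: inclM| |].
  exact: (rderD SS0 smS smS0).
exact: (rderZ SS0 smS smS0).
Qed.

Lemma ext_restr0 : res 0 = 0.
Proof. by apply: (addrI (res 0)); rewrite -ext_restrD !addr0. Qed.

Lemma ext_restr_sum (I : Type) (r : seq I) (P : pred I) (F : I -> _) :
  res (\sum_(i <- r | P i) F i) = \sum_(i <- r | P i) res (F i).
Proof. exact: (big_morph res ext_restrD ext_restr0). Qed.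

Lemma rder_bder j :
  rder S0 (bder K smS j) = mono K S0 (- pole B' J j) *: dv S0T (col j C).
Proof.
apply: (rder_uniq SS0 smS smS0) => f; apply: val_inj.
rewrite derZE monalg_valM monoE // dvE !inclE // mkderE.
by rewrite /extN map_col.
Qed.

Definition poleI I : latM n := \sum_(j < k) pole B' J (enumI I j).

Lemma poleI_coord I i : #|I| = k -> i \in J -> (poleI I *m B) 0 i = (i \in I)%:R.
Proof.
move=> cI iJ; rewrite /poleI mulmx_suml summxE.
have poleE j : (pole B' J j *m B) 0 i = (j == i)%:R.
  rewrite /pole; case: ifP => jJ; first exact: (dual_basisE smS).
  by rewrite mul0mx mxE; case: eqP => // ji; rewrite ji iJ in jJ.
case: (boolP (i \in I)) => iI.
  have [j Ej] := enumI_onto kn cI iI.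
  rewrite (bigD1 j) //= poleE Ej eqxx big1 ?addr0 // => l lj.
  by rewrite poleE -Ej (inj_eq (enumI_inj cI)) (negPf lj).
rewrite big1 // => j _; rewrite poleE; case: eqP => // ji.
by move: iI; rewrite -ji enumI_in.
Qed.

Lemma prod_mono (T : addrClosed (latM n)) (I : finType) (F : I -> latM n) :
  (forall i, F i \in T) -> \prod_i mono K T (F i) = mono K T (\sum_i F i).
Proof.
move=> FT; suff: mono K T (\sum_i F i) = \prod_i mono K T (F i) /\ \sum_i F i \in T by case.
elim/big_rec2: _ => [|i x y _ [<- yT]]; last by rewrite monoD // rpredD.
by split; rewrite ?rpred0 //; apply: val_inj; rewrite monoE ?rpred0 // val_monalg1.
Qed.

Lemma ext_restr_bder I :
  res (wedgeI kn (bder K smS) I) = mono K S0 (- poleI I) *: dvI kn S0T C I.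
Proof.
rewrite ext_restr_wedge /poleI -sumrN -prod_mono // -wedge_scale.
by congr wedge; apply/ffunP => j; rewrite !ffunE rder_bder.
Qed.

Let incl_eq0 (a : A) I : monalg_incl S0 a * mono K S0 (- poleI I) = 0 -> a = 0.
Proof.
move=> a0; apply: val_inj; rewrite -(inclE SS0).
have : monalg_incl S0 a * mono K S0 (- poleI I) * mono K S0 (poleI I) = 0.
  by rewrite a0 mul0r.
move=> /(congr1 val); rewrite !monalg_valM !monoE // -mulrA gexpNK mulr1 => ->.
by rewrite !raddf0.
Qed.

(** Restriction is diagonal: it multiplies the coordinate on I by chi^(-poleI I), a unit on the
    torus. Injectivity and the necessity of the condition on the image both come from this
    formula. *)
Let resE w : exists a : {set 'I_n} -> A,
  w = \sum_(I : {set 'I_n} | #|I| == k) a I *: wedgeI kn (bder K smS) I /\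
  forall I, #|I| = k ->
    pl (rowsub (enumI I) C') (res w) = monalg_incl S0 (a I) * mono K S0 (- poleI I).
Proof.
have [a Ea] := wedgeI_span kn (bder_expand smS) w.
exists a; split=> // I cI; rewrite Ea ext_restr_sum pl_sum (bigD1 I) ?cI //=.
rewrite ext_restrZ ext_restr_bder plZ plZ (pl_dual _ _ dual_basis_map) // eqxx mulr1.
rewrite big1 ?addr0 // => L /andP[/eqP cL LI].
rewrite ext_restrZ ext_restr_bder plZ plZ (pl_dual _ _ dual_basis_map) //.
by rewrite eq_sym (negPf LI) !mulr0.
Qed.

Lemma ext_restr_inj w : res w = 0 -> w = 0.
Proof.
move=> w0; have [a [Ew aE]] := resE w; rewrite Ew; apply: big1 => I /eqP cI.
have := aE I cI; rewrite w0 pl0 => /esym/incl_eq0 ->.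
exact: scale0r.
Qed.

Lemma ext_restr_lin (I : finType) (c : I -> K) (w : I -> extpow (der A) k) :
  res (\sum_i (c i)%:A *: w i) = \sum_i (c i)%:A *: res (w i).
Proof.
rewrite ext_restr_sum; apply: eq_bigr => i _.
by rewrite ext_restrZ (inclZ SS0) (incl1 _ SS0).
Qed.

Lemma ext_restr_injective : injective res.
Proof.
move=> v w vw; apply/eqP; rewrite -subr_eq0; apply/eqP/ext_restr_inj.
by apply: (addIr (res w)); rewrite -ext_restrD subrK add0r.
Qed.

(** On [J] the coordinates of [poleI I] are the indicator of I, so the bound says that m + [poleI I]
    is in [S]: the coordinate of [z] on I becomes regular on the chart once multiplied by chi^(poleI
    I). *)
Lemma ext_restr_image (z : extpow (der A0) k) :
  (exists w, res w = z) <->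
  (forall I, #|I| = k -> forall m, plm (rowsub (enumI I) C') m z != 0 ->
     forall j, j \in J -> 0 <= (m *m B) 0 j + (j \in I)%:R).
Proof.
have supp I (a : A) m : #|I| = k ->
  fcoef (val (monalg_incl S0 a * mono K S0 (- poleI I))) m = fcoef (val a) (m + poleI I).
  by move=> cI; rewrite monalg_valM monoE // mulrC fcoef_gexpM opprK inclE.
split=> [[w <-] I cI m + j jJ|zP].
  have [a [_ aE]] := resE w.
  rewrite /plm aE // supp // => /monalg_supp; rewrite smS.2 => /forall_inP/(_ j jJ).
  by rewrite mulmxDl mxE poleI_coord.
pose b I : A := mkmon S (gexp (poleI I) * val (pl (rowsub (enumI I) C') z)).
have bE I : #|I| = k -> val (b I) = gexp (poleI I) * val (pl (rowsub (enumI I) C') z).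
  move=> cI; apply/mkmonE/supported_inP => m; rewrite fcoef_gexpM => m0.
  rewrite smS.2; apply/forall_inP => j jJ.
  have := zP I cI _ m0 j jJ; rewrite -(poleI_coord cI jJ).
  by rewrite -[X in 0 <= X -> _]/(_ + _) mulmxBl mxE [X in _ + X + _]mxE subrK.
exists (\sum_(I : {set 'I_n} | #|I| == k) b I *: wedgeI kn (bder K smS) I).
rewrite ext_restr_sum [RHS](pl_expand kn S0T _ dual_basis_map).
apply: eq_bigr => I /eqP cI; rewrite ext_restrZ ext_restr_bder scalerA.
suff -> : monalg_incl S0 (b I) * mono K S0 (- poleI I) =
    pl (rowsub (enumI I) C') z by [].
apply: val_inj; rewrite monalg_valM inclE // bE // monoE // mulrAC -gexpD subrr.
by rewrite gexp0 mul1r.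
Qed.

End Restriction.

Section Functoriality.
Variables (K : fieldType) (n k : nat) (S1 S2 : addrClosed (latM n)).
Hypothesis S12 : {subset S1 <= S2}.
Variables (B B' : 'M[int]_n) (J1 J2 : {set 'I_n}).
Hypotheses (sm1 : smooth_monoid S1 B B' J1) (sm2 : smooth_monoid S2 B B' J2).

Let r1 := incl1 K S12.
Let rD := @inclD K _ _ _ S12.
Let rM := @inclM K _ _ _ S12.
Let dD := rderD (K := K) S12 sm1 sm2.
Let dZ := rderZ (K := K) S12 sm1 sm2.
Local Notation res := (@ext_restr K n k _).

(** Allows compatibility between two charts to be tested on the torus; on each vector field it is
    the uniqueness of the extension. *)
Lemma ext_restr_comp (S0 : addrClosed (latM n)) (S0T : forall m, m \in S0)
    (w : extpow (der (monalg K S1)) k) :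
  res S0 (res S2 w) = res S0 w.
Proof.
move: w; apply: (ext_map_ind (rho := @monalg_incl K _ S1 S0)).
- move=> v w; rewrite [res S2 _]/ext_restr (ext_mapD r1 rD rM dD dZ).
  exact: (ext_restrD S0T sm2).
- move=> a w; rewrite [res S2 _]/ext_restr (ext_mapZ r1 rD rM dD dZ).
  rewrite (ext_restrZ S0T sm2); congr (_ *: _).
  by apply: val_inj; rewrite !inclE.
- exact: (ext_restrD S0T sm1).
- exact: (ext_restrZ S0T sm1).
move=> x; rewrite (ext_restr_wedge S0T sm1) [res S2 _]/ext_restr (ext_map_wedge r1 rD rM dD dZ).
rewrite (ext_restr_wedge S0T sm2); congr wedge; apply/ffunP => i; rewrite !ffunE.
have S10 : {subset S1 <= S0} by move=> m _; exact: S0T.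
have S20 : {subset S2 <= S0} by move=> m _; exact: S0T.
apply/esym/(rder_uniq S10 sm1 (smooth_all S0T sm1.1)) => f.
have -> : monalg_incl S0 f = monalg_incl S0 (monalg_incl S2 f).
  by apply: val_inj; rewrite !inclE.
rewrite (rderP S20 sm2 (smooth_all S0T sm2.1)) (rderP S12 sm1 sm2).
by apply: val_inj; rewrite !inclE.
Qed.

End Functoriality.

(** * The torus action on polyvector fields *)

Section TorusAction.
Variables (K : fieldType) (n k : nat).
Implicit Types (S : addrClosed (latM n)) (t : torus K n).

Definition ext_act S t (w : extpow (der (monalg K S)) k) : extpow (der (monalg K S)) k :=
  ext_map (@tpull K n S (torusV t)) (@der_push K n S t) w.

Lemma tpull1 S t : tpull t (1 : monalg K S) = 1.
Proof.
apply/val_inj/fmodP => m; rewrite tpull_val gpullE val_monalg1 fcoef_term.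
by case: eqP => [->|]; rewrite ?chi0 ?mulr1 ?mulr0.
Qed.

Lemma tpull_scalar S t c : tpull t (c%:A : monalg K S) = c%:A.
Proof.
apply/val_inj/fmodP => m; rewrite tpull_val gpullE monalg_valZ val_monalg1 fcoefZ fcoef_term.
by case: eqP => [->|]; rewrite ?chi0 ?mul1r ?mulr0.
Qed.

Lemma der_pushD S t : {morph @der_push K n S t : D E / D + E}.
Proof. by move=> D E; apply/val_inj/funext => f; exact: tpullD. Qed.

Lemma der_pushZ S t (a : monalg K S) D :
  der_push t (a *: D) = tpull (torusV t) a *: der_push t D.
Proof.
apply/val_inj/funext => f.
rewrite -[LHS]/(tpull (torusV t) ((a *: D) (tpull t f))) derZE tpullM.
have E : der_push t D f = tpull (torusV t) (D (tpull t f)) by [].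
rewrite -E.
exact: (esym (derZE (tpull (torusV t) a) (der_push t D) f)).
Qed.

Lemma ext_actD S t v w : @ext_act S t (v + w) = ext_act t v + ext_act t w.
Proof.
apply: ext_mapD; [exact: tpull1|exact: tpullD|exact: tpullM| |].
  exact: der_pushD.
exact: der_pushZ.
Qed.

Lemma ext_actZ S t a w : @ext_act S t (a *: w) = tpull (torusV t) a *: ext_act t w.
Proof.
apply: ext_mapZ; [exact: tpull1|exact: tpullD|exact: tpullM| |].
  exact: der_pushD.
exact: der_pushZ.
Qed.

Lemma ext_act_wedge S t x :
  @ext_act S t (wedge x) = wedge [ffun i => der_push t (x i)].
Proof.
apply: ext_map_wedge; [exact: tpull1|exact: tpullD|exact: tpullM| |].
  exact: der_pushD.
exact: der_pushZ.
Qed.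

Lemma tpull_mono S t m : m \in S -> tpull t (mono K S m) = chi m t *: mono K S m.
Proof.
move=> mS; apply/val_inj/fmodP => a; rewrite tpull_val monalg_valZ !monoE //.
rewrite gpullE fcoefZ fcoef_term; case: eqP => [->//|]; by rewrite !mulr0.
Qed.

(** The fields [dv] are translation invariant, so only chi^m is moved; it becomes chi^m composed
    with t^(-1), whence the sign of the weight. *)
Lemma ext_act_xdv (kn : (k <= n)%N) S (ST : forall m, m \in S) t m (C : 'M[K]_n) I :
  ext_act t (xdv kn ST m C I) = (chi (- m) t)%:A *: xdv kn ST m C I.
Proof.
have W : ext_act t (dvI kn ST C I) = dvI kn ST C I.
  rewrite [LHS]ext_act_wedge.
  suff E (v : 'cV[K]_n) : der_push t (dv ST v) = dv ST v.
    by rewrite /dvI /wedgeI; congr wedge; apply/ffunP => j; rewrite !ffunE E.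
  apply/val_inj/funext => f; apply: val_inj; apply/fmodP => a.
  rewrite -[LHS]/(fcoef (gpull (torusV t) (val (dv ST v (tpull t f)))) a).
  rewrite gpullE !dvE !logdE tpull_val gpullE.
  by rewrite chiV mulrCA mulKf ?chi_neq0.
have chiN : chi (- m) t = chi m (torusV t).
  rewrite chiV; apply: (mulIf (chi_neq0 m t)).
  by rewrite -chiD addNr chi0 mulVf ?chi_neq0.
by rewrite /xdv ext_actZ W tpull_mono // chiN [RHS]scalerA mulr_algl.
Qed.

Lemma ext_act_restr (S1 S2 : addrClosed (latM n)) (S12 : {subset S1 <= S2})
    (B B' : 'M[int]_n) (J1 J2 : {set 'I_n})
    (sm1 : smooth_monoid S1 B B' J1) (sm2 : smooth_monoid S2 B B' J2) t w :
  ext_restr S2 (@ext_act S1 t w) = ext_act t (ext_restr S2 w).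
Proof.
pose r1 := incl1 K S12.
pose rD := @inclD K _ _ _ S12.
pose rM := @inclM K _ _ _ S12.
pose dD := rderD (K := K) S12 sm1 sm2.
pose dZ := rderZ (K := K) S12 sm1 sm2.
have tincl u (f : monalg K S1) :
    tpull u (monalg_incl S2 f) = monalg_incl S2 (tpull u f).
  apply: val_inj; rewrite (inclE S12).
  rewrite -[LHS]/(gpull u (val (monalg_incl S2 f))) -[RHS]/(gpull u (val f)).
  by rewrite (inclE S12).
have resD (v z : extpow (der (monalg K S1)) k) :
    ext_restr S2 (v + z) = ext_restr S2 v + ext_restr S2 z.
  exact: (ext_mapD r1 rD rM dD dZ).
have resZ a (z : extpow (der (monalg K S1)) k) :
    ext_restr S2 (a *: z) = monalg_incl S2 a *: ext_restr S2 z.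
  exact: (ext_mapZ r1 rD rM dD dZ).
move: w; apply: (ext_map_ind (rho := fun a => monalg_incl S2 (tpull (torusV t) a))).
- by move=> v w; rewrite ext_actD resD.
- by move=> a w; rewrite ext_actZ resZ.
- by move=> v w; rewrite resD ext_actD.
- by move=> a w; rewrite resZ ext_actZ tincl.
move=> x; rewrite ext_act_wedge /ext_restr !(ext_map_wedge r1 rD rM dD dZ) ext_act_wedge.
congr wedge; apply/ffunP => i; rewrite !ffunE.
apply: (rder_uniq S12 sm1 sm2) => f.
rewrite -[LHS]/(tpull _ (rder S2 (x i) (tpull t (monalg_incl S2 f)))).
by rewrite tincl (rderP S12 sm1 sm2) tincl.
Qed.

End TorusAction.

(** * Representations with a basis of weight vectors *)

Section Dimension.
Variables (K : fieldType) (E : lmodType K).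
Implicit Types (V : set E).

Lemma lspan_rangeP d (b : 'I_d -> E) v :
  lspan (range b) v <-> exists a : 'I_d -> K, v = \sum_i a i *: b i.
Proof.
split=> [[e [c [w [wb ->]]]]|[a ->]].
  have /choice[f fE] i : exists j, b j = w i by have [j _ <-] := wb i; exists j.
  (* The same [b j] may occur several times in the family; its coefficients are added. *)
  exists (fun j => \sum_(i | f i == j) c i).
  rewrite (partition_big f xpredT) //=; apply: eq_bigr => j _.
  by rewrite scaler_suml; apply: eq_bigr => i /eqP <-; rewrite fE.
by exists d, a, b; split=> // i; exists i.
Qed.

Lemma basis_leq V d d' (b : 'I_d -> E) (b' : 'I_d' -> E) :
  is_basis V b -> is_basis V b' -> (d' <= d)%N.
Proof.
move=> [_ Vb] [free' Vb'].
have /choice[a aE] j : exists a : 'I_d -> K, b' j = \sum_i a i *: b i.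
  by apply/lspan_rangeP; rewrite -Vb Vb'; apply/lspan_rangeP; exists (fun i => (i == j)%:R);
    rewrite (bigD1 j) //= eqxx scale1r big1 ?addr0 // => i /negPf->; rewrite scale0r.
rewrite leqNgt; apply/negP => dd'.
pose M : 'M[K]_(d', d) := \matrix_(j, i) a j i.
have : kermx M != 0.
  rewrite kermx_eq0 /row_free neq_ltn.
  by rewrite (leq_ltn_trans (rank_leq_col M) dd').
move=> /rowV0Pn[x /sub_kermxP xM x0].
have xj j : x 0 j = 0.
  apply: (free' (x 0)); under eq_bigr do rewrite aE scaler_sumr.
  rewrite exchange_big big1 // => i _ /=.
  transitivity ((x *m M) 0 i *: b i); last by rewrite xM mxE scale0r.
  by rewrite mxE scaler_suml; apply: eq_bigr => l _; rewrite scalerA mxE.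
by move/eqP: x0; apply; apply/rowP => j; rewrite xj mxE.
Qed.

Lemma subdimE V d (b : 'I_d -> E) : is_basis V b -> subdim V = d.
Proof.
move=> bV; rewrite /subdim; case: xgetP => [e _ [b' b'V]|/(_ d)]; last first.
  by case; exists b.
by apply/eqP; rewrite eqn_leq (basis_leq bV b'V) (basis_leq b'V bV).
Qed.

(** Indexed by any finite type, since the basis of global sections is indexed by pairs of a lattice
    point and a subset. *)
Definition fin_basis V (I : finType) (b : I -> E) : Prop :=
  (forall c : I -> K, \sum_i c i *: b i = 0 -> forall i, c i = 0) /\
  (forall v, V v <-> exists c : I -> K, v = \sum_i c i *: b i).

Lemma fin_basis_is_basis V (I : finType) (b : I -> E) :
  fin_basis V b -> is_basis V (fun i : 'I_#|I| => b (enum_val i)).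
Proof.
move=> [bI bV]; split=> [c|].
  move=> c0 i; rewrite -(enum_valK i); apply: (bI (c \o enum_rank)).
  rewrite -[RHS]c0 (reindex _ (onW_bij _ (@enum_val_bij I))).
  by apply: eq_bigr => j _; rewrite /= enum_valK.
apply/seteqP; split=> v.
  move=> /bV[c ->]; apply/lspan_rangeP; exists (c \o enum_val).
  by rewrite (reindex _ (onW_bij _ (@enum_val_bij I))).
move=> /lspan_rangeP[c ->]; apply/bV; exists (c \o enum_rank).
rewrite [RHS](reindex _ (onW_bij _ (@enum_val_bij I))).
by apply: eq_bigr => j _; rewrite /= enum_valK.
Qed.

Lemma subdim_fin V (I : finType) (b : I -> E) : fin_basis V b -> subdim V = #|I|.
Proof. by move/fin_basis_is_basis/subdimE. Qed.

End Dimension.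

Section Characters.
Variables (K : numFieldType) (n : nat).

Lemma expz2_inj (a b : int) : (2%:R : K) ^ a = 2%:R ^ b -> a = b.
Proof.
have two0 : 2%:R != 0 :> K by rewrite pnatr_eq0.
have key (z : nat) : (2%:R : K) ^ z%:Z = 1 -> z = 0%N.
  case: z => // z; rewrite -exprnP => E; have : 1 < (2%:R : K) ^+ z.+1.
    by rewrite exprn_egt1 // ltr1n.
  by rewrite E ltxx.
wlog le : a b / a <= b => [W|].
  by case/orP: (le_total a b) => ab E; [|apply/esym]; apply: W.
move=> E; have [c bac] : exists c : nat, b - a = c%:Z.
  by exists `|b - a|%N; rewrite gez0_abs // subr_ge0.
have : (2%:R : K) ^ c%:Z = 1.
  by rewrite -bac expfzDr // -invr_expz -E mulfV // expfz_neq0.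
by move/key => c0; apply/esym/eqP; rewrite -subr_eq0 bac c0.
Qed.

(** Tested at the point with i-th coordinate 2 and all others 1: the integral powers of 2 are
    pairwise distinct in a numeric field. *)
Lemma chi_inj (m m' : latM n) : (forall t : torus K n, chi m t = chi m' t) -> m = m'.
Proof.
move=> mm'; apply/rowP => i.
have tP : [forall j, (\col_j (if j == i then 2%:R else 1) : 'cV[K]_n) j 0 != 0].
  by apply/forallP => j; rewrite mxE; case: ifP => _; rewrite ?oner_neq0 ?pnatr_eq0.
have chiE p : chi p (Torus tP) = 2%:R ^ p 0 i.
  rewrite /chi (bigD1 i) //= mxE eqxx big1 ?mulr1 // => j /negPf ji.
  by rewrite mxE ji exp1rz.
by have := mm' (Torus tP); rewrite !chiE => /expz2_inj.
Qed.

Lemma laurent_eval_gexp (m : latM n) (t : torus K n) :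
  laurent_eval (gexp m) t = chi m t.
Proof.
rewrite /laurent_eval (big_fset_incl _ (fsupp_term 1 m)) /=.
  by rewrite big_seq_fset1 fcoef_term eqxx mul1r.
by move=> a _ /fcoef_out->; rewrite mul0r.
Qed.

Lemma laurent_eval0 (t : torus K n) : laurent_eval 0 t = 0.
Proof. by rewrite /laurent_eval big1_fset // => a _ _; rewrite fcoef0 mul0r. Qed.

Lemma chi_torus1 (m : latM n) : chi m (torus1 K n) = 1.
Proof. by rewrite /chi big1 // => i _; rewrite /= mxE exp1rz. Qed.

Lemma chi_torusM (m : latM n) (s t : torus K n) : chi m (torusM s t) = chi m s * chi m t.
Proof. by rewrite /chi -big_split; apply: eq_bigr => i _; rewrite /= mxE expfzMl. Qed.

End Characters.

Section WeightBasis.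
Variables (K : numFieldType) (n : nat) (E : lmodType K).
Variables (act : torus K n -> E -> E) (V : set E).
Variables (I : finType) (b : I -> E) (mu : I -> latM n).
Hypothesis actD : forall t v w, act t (v + w) = act t v + act t w.
Hypothesis actZ : forall t c v, act t (c *: v) = c *: act t v.
Hypothesis bV : fin_basis V b.
Hypothesis act_b : forall t i, act t (b i) = chi (mu i) t *: b i.

Let act_sum t (c : I -> K) :
  act t (\sum_i c i *: b i) = \sum_i (c i * chi (mu i) t) *: b i.
Proof.
have act0 : act t 0 = 0 by rewrite -[X in act t X](scale0r (0 : E)) actZ scale0r.
rewrite (big_morph (act t) (actD t) act0); apply: eq_bigr => i _.
by rewrite actZ act_b scalerA.
Qed.

Lemma weight_basis_rep : fd_rational_rep act V.
Proof.
have [bI bS] := bV; split.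
- by move=> t v /bS[c ->]; apply/bS; exists (fun i => c i * chi (mu i) t); rewrite act_sum.
- move=> v /bS[c ->]; rewrite act_sum; apply: eq_bigr => i _.
  by rewrite chi_torus1 mulr1.
- move=> s t v /bS[c ->]; rewrite !act_sum; apply: eq_bigr => i _.
  by rewrite chi_torusM mulrA mulrAC.
- by move=> t c v w _ _; rewrite actD actZ.
exists #|I|, (fun i => b (enum_val i)).
exists (fun i j => if i == j then gexp (mu (enum_val j)) else 0).
split; first exact: fin_basis_is_basis.
move=> t j; rewrite act_b (bigD1 j) //= eqxx laurent_eval_gexp big1 ?addr0 //.
by move=> i /negPf ->; rewrite laurent_eval0 scale0r.
Qed.

Lemma weight_basis_dim m : subdim (weight_space act V m) = #|[set i | mu i == m]%SET|.
Proof.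
have [bI bS] := bV.
have sum_sub (c : {i | mu i == m} -> K) :
    \sum_i c i *: b (val i) = \sum_i (if insub i is Some j then c j else 0) *: b i.
  rewrite [RHS](bigID (fun i => mu i == m)) /= [X in _ = _ + X]big1 ?addr0; last first.
    by move=> i /negPf im; rewrite insubF // scale0r.
  rewrite [RHS](reindex_omap (val : {i | mu i == m} -> I) insub) /=; last first.
    by move=> i im; rewrite insubT.
  by apply: eq_big => i; rewrite valK ?eqxx ?(valP i).
rewrite (@subdim_fin _ _ _ {i | mu i == m} (fun i => b (val i))).
  by rewrite card_sig; apply: eq_card => i; rewrite !inE.
split=> [c|v].
  rewrite sum_sub => /bI c0 i.
  by have := c0 (val i); rewrite valK.
split=> [[/bS[c Ev] vm]|[c ->]].
  exists (fun i => c (val i)); rewrite Ev sum_sub; apply: eq_bigr => i _.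
  have [im|im] := boolP (mu i == m); first by rewrite insubT /=.
  rewrite insubN //; suff -> : c i = 0 by [].
  (* A point separating the two characters forces the coefficient of [b i] to vanish. *)
  have [t tm] : exists t : torus K n, ~ (chi (mu i) t = chi m t).
    by apply/existsNP => eqchi; rewrite (chi_inj eqchi) eqxx in im.
  have := vm t; rewrite Ev act_sum scaler_sumr => /eqP.
  rewrite -subr_eq0 -sumrB; under eq_bigr do rewrite scalerA -scalerBl.
  move=> /eqP/bI/(_ i)/eqP; rewrite mulrC -mulrBl mulf_eq0 subr_eq0.
  by case/orP => /eqP.
rewrite sum_sub; split; first by apply/bS; eexists.
move=> t; rewrite act_sum scaler_sumr; apply: eq_bigr => i _; rewrite scalerA mulrC.
have [im|im] := boolP (mu i == m); first by rewrite (eqP im).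
by rewrite insubN // !mulr0.
Qed.

End WeightBasis.

(** The sum over all of M is reindexed by m -> -m, so that weights become points of [X], outside of
    which the dimensions vanish. *)
Lemma formal_charE (K : fieldType) n (E : lmodType K) (act : torus K n -> E -> E) (V : set E)
    (X : {fset latM n}) (N : latM n -> nat) :
  (forall m, subdim (weight_space act V (- m)) = if m \in X then N m else 0%N) ->
  formal_char act V = \sum_(m <- X) (N m)%:Z *: gexp (- m).
Proof.
move=> dimV; rewrite /formal_char (reindex_fsbigT (-%R : latM n -> latM n)); last first.
  by exists (fun m : latM n => - m) => m; rewrite /= opprK.
rewrite -(fsbig_widen [set` X]) //=.
  rewrite fsbig_finite ?set_fsetK //=; apply: eq_big_seq => m mX.
  by rewrite dimV mX.
by move=> m [_ /negP mX]; rewrite /= dimV (negPf mX) scale0r.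
Qed.

(** * Adapted bases and the number of index sets *)

Section AdaptedBasis.
Variables (K : fieldType).

Lemma lspan_sub (E : lmodType K) (S : set E) d (b : 'I_d -> E) :
  (forall i, S (b i)) -> (forall v, S v -> lspan (range b) v) ->
  lspan S = lspan (range b).
Proof.
move=> Sb bS; apply/seteqP; split=> v.
  move=> [e [c [w [wS ->]]]].
  have /choice[a aE] i : exists a : 'I_d -> K, w i = \sum_j a j *: b j.
    by apply/lspan_rangeP/bS/wS.
  apply/lspan_rangeP; exists (fun j => \sum_i c i * a i j).
  under eq_bigr do rewrite aE scaler_sumr.
  rewrite exchange_big; apply: eq_bigr => j _; rewrite scaler_suml.
  by apply: eq_bigr => i _; rewrite scalerA.
by move/lspan_rangeP => [a ->]; exists d, a, b.
Qed.

Lemma row_free_lin d n (M : 'M[K]_(d, n)) (c : 'I_d -> K) :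
  row_free M -> \sum_i c i *: row i M = 0 -> forall i, c i = 0.
Proof.
move=> fM c0 i; have : (\row_j c j) *m M = 0.
  by rewrite mulmx_sum_row -[RHS]c0; apply: eq_bigr => j _; rewrite mxE.
rewrite -(mul0mx _ M) => /(row_free_inj fM)/rowP/(_ i).
by rewrite !mxE.
Qed.

(** A free family of vectors of [S] of the largest size is completed to a basis of the whole space
    by a complement of its span. *)
Lemma adapted_basis n (S : set 'cV[K]_n) :
  exists (i : nat) (C C' : 'M[K]_n), [/\ (i <= n)%N, C' *m C = 1%:M,
    forall j : 'I_n, (j < i)%N -> S (col j C),
    forall v, S v -> exists a : 'I_n -> K, v = \sum_(j < n | (j < i)%N) a j *: col j C &
    subdim (lspan S) = i].
Proof.
pose P d := `[< exists M : 'M[K]_(d, n), row_free M /\ forall j, S (row j M)^T >].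
have P0 : exists d, P d.
  exists 0%N; apply/asboolP; exists 0; split; last by case.
  by rewrite /row_free mxrank0.
have Pn d : P d -> (d <= n)%N.
  by move=> /asboolP[M [/eqP fM _]]; rewrite -fM; exact: rank_leq_col.
have [i /asboolP[M [fM MS]] imax] := ex_maxnP P0 Pn.
(* A vector of [S] outside the row space could be appended to [M], against the maximality of [i]. *)
have MspanS v : S v -> (v^T <= M)%MS.
  move=> vS; apply: contraT => vM.
  exfalso.
  suff /imax : P (i + 1)%N by rewrite addn1 ltnn.
  apply/asboolP; exists (col_mx M v^T); split.
    rewrite -row_leq_rank -addsmxE addn1.
    rewrite -[X in (X < _)%N](eqP fM).
    apply: rank_ltmx; rewrite ltmxE addsmxSl /=.
    by apply: contra vM => /(submx_trans _); apply; exact: addsmxSr.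
  move=> j; rewrite -(splitK j); case: (fintype.split j) => l /=.
    by rewrite rowKu; exact: MS.
  by rewrite rowKd ord1 row_id trmxK.
(* The completed matrix has i + rank(M^C) rows; naming this number [N], with N = n, lets a
   substitution replace a cast. *)
have [N [W [eN fW WS WE]]] : exists N (W : 'M[K]_(N, n)), [/\ N = n, row_full W,
    forall j : 'I_N, (j < i)%N -> S (row j W)^T &
    forall x : 'rV[K]_i, exists a : 'I_N -> K,
      x *m M = \sum_(j < N | (j < i)%N) a j *: row j W].
  exists (i + \rank (M^C)%MS)%N, (col_mx M (row_base (M^C)%MS)); split.
  - rewrite mxrank_compl; rewrite (eqP fM).
    by rewrite subnKC // Pn //; apply/asboolP; exists M.
  - rewrite -sub1mx -addsmxE.
    apply: submx_trans (_ : M + M^C <= _)%MS; first by rewrite sub1mx addsmx_compl_full.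
    by rewrite addsmxS // eq_row_base.
  - move=> j; rewrite -(splitK j); case: (fintype.split j) => l /=.
      by rewrite rowKu => _; exact: MS.
    by rewrite ltnNge leq_addr.
  - move=> x; exists (fun j => if fintype.split j is inl l then x 0 l else 0).
    rewrite big_split_ord /= [X in _ = _ + X]big_pred0 ?addr0; last first.
      by move=> j; rewrite ltnNge leq_addr.
    rewrite mulmx_sum_row; apply: eq_big => [j|j _]; first by rewrite ltn_ord.
    by rewrite rowKu (unsplitK (inl j)).
subst N; exists i, W^T, (invmx W^T); split.
- by apply: Pn; apply/asboolP; exists M.
- by rewrite mulVmx // unitmx_tr -row_full_unit.
- by move=> j ji; rewrite -tr_row; exact: WS.
- move=> v /MspanS/submxP[x Ev]; have [a aE] := WE x; exists a.
  rewrite -[v]trmxK Ev aE linear_sum; apply: eq_bigr => j _.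
  by rewrite linearZ /= tr_row.
apply: (@subdimE _ _ _ _ (fun j : 'I_i => (row j M)^T)); split.
  move=> c; under eq_bigr do rewrite -linearZ.
  rewrite -linear_sum => /(congr1 trmx); rewrite trmxK trmx0.
  exact: row_free_lin.
apply: lspan_sub => [//|v /MspanS/submxP[x Ev]].
apply/lspan_rangeP; exists (x 0); rewrite -[v]trmxK Ev mulmx_sum_row linear_sum.
by apply: eq_bigr => j _; rewrite linearZ.
Qed.

End AdaptedBasis.

(** Such a subset is the initial segment [L] together with a (k - i)-subset of its complement. The
    test i <= k matters: for k < i the truncated subtraction would give 1 instead of 0. *)
Lemma card_supersets (n k i : nat) : (i <= n)%N ->
  #|[set I : {set 'I_n} | (#|I| == k) && [forall j : 'I_n, (j < i)%N ==> (j \in I)]]%SET|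
    = if (i <= k)%N then 'C(n - i, k - i) else 0%N.
Proof.
move=> le_in; pose L := [set j : 'I_n | (j < i)%N]%SET.
have cL : #|L| = i.
  have wI : injective (widen_ord le_in) by move=> a b /(congr1 val) /= ?; apply: val_inj.
  rewrite -[RHS]card_ord -(card_imset _ wI).
  apply: eq_card => j; rewrite inE; apply/idP/imsetP => [ji|[l _ ->]] /=; last exact: ltn_ord.
  by exists (Ordinal ji) => //; apply: val_inj.
have subL (I : {set 'I_n}) : [forall j : 'I_n, (j < i)%N ==> (j \in I)] = (L \subset I).
  apply/forall_inP/fintype.subsetP => LI j; last by move=> ji; apply: LI; rewrite inE.
  by rewrite inE; exact: LI.
have cC : #|finset.setC L| = (n - i)%N by rewrite cardsCs finset.setCK card_ord cL.
case: ifPn => [ik|]; last first.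
  rewrite -ltnNge => ki; apply/eqP; rewrite cards_eq0 -finset.subset0.
  apply/fintype.subsetP => I; rewrite !inE subL => /andP[/eqP cI /subset_leq_card].
  by rewrite cL cI leqNgt ki.
rewrite -cC -cards_draws -(card_in_imset (f := fun D => L :|: D)%SET); last first.
  move=> D E; rewrite !inE => /andP[DL _] /andP[EL _] LDE.
  have dE (D' : {set 'I_n}) : D' \subset finset.setC L -> ((L :|: D') :\: L)%SET = D'.
    move=> D'L; rewrite finset.setDUl finset.setDv finset.set0U.
    by apply/finset.setDidPl; rewrite finset.disjoints_subset.
  by rewrite -(dE D DL) LDE dE.
apply: eq_card => I; rewrite !inE subL; apply/andP/imsetP => [[/eqP cI LI]|[D + ->]].
  exists (I :\: L)%SET;
    last by rewrite finset.setUC finset.setDE finset.setUIl [X in _ :&: X]finset.setUC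
      finset.setUCr finset.setIT; apply/esym/finset.setUidPl.
  by rewrite inE finset.setDE finset.subsetIr /= -finset.setDE cardsD (finset.setIidPr LI) cI cL.
rewrite inE => /andP[DL /eqP cD]; split; last exact: finset.subsetUl.
rewrite cardsU cL cD (_ : L :&: D = finset.set0) ?cards0 ?subn0 ?subnKC //.
by apply/eqP; rewrite finset.setI_eq0 disjoint_sym finset.disjoints_subset.
Qed.

(** * Cones and fans *)

Section Cones.
Variables (R : realType) (n : nat).
Implicit Types (B : 'M[int]_n) (J : {set 'I_n}) (x : 'cV[R]_n) (m : latM n).

Definition scone B J : set 'cV[R]_n := @cone R n [seq col j B | j <- enum J].

Lemma cone_nil x : @cone R n [::] x <-> x = 0.
Proof.
split=> [[c [_ ->]]|->]; first by rewrite big_ord0.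
by exists (fun=> 0); split=> //; rewrite big_ord0.
Qed.

Lemma cone_cons (v : latN n) s x : @cone R n (v :: s) x <->
  exists a y, [/\ 0 <= a, @cone R n s y & x = a *: extN R v + y].
Proof.
split=> [[c [c0 ->]]|[a [y [a0 [c [c0 ->]] ->]]]].
  exists (c ord0), (\sum_(i < size s) c (lift ord0 i) *: extN R s`_i).
  split=> //; last by rewrite big_ord_recl.
  by exists (fun i => c (lift ord0 i)).
exists (fun i => if unlift ord0 i is Some j then c j else a); split=> [i|].
  by case: unlift.
rewrite [RHS]big_ord_recl unlift_none; congr (_ + _); apply: eq_bigr => i _.
by rewrite liftK.
Qed.

Lemma cone_mapP (e : seq 'I_n) B x : uniq e -> @cone R n [seq col j B | j <- e] x <->
  exists c : 'I_n -> R, (forall j, 0 <= c j) /\ x = \sum_(j <- e) c j *: extN R (col j B).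
Proof.
elim: e x => [|i e IH] x /=.
  move=> _; rewrite cone_nil; split=> [->|[c [_ ->]]]; last by rewrite big_nil.
  by exists (fun=> 0); split=> //; rewrite big_nil.
move=> /andP[ie ue]; rewrite cone_cons.
split=> [[a [y [a0 /IH-/(_ ue)[c [c0 ->]] ->]]]|[c [c0 ->]]].
  exists (fun j => if j == i then a else c j); split=> [j|]; first by case: ifP.
  rewrite big_cons eqxx; congr (_ + _); apply: eq_big_seq => j je.
  by case: eqP => // ji; move: ie; rewrite -ji je.
exists (c i), (\sum_(j <- e) c j *: extN R (col j B)); split=> //; last by rewrite big_cons.
by apply/IH => //; exists c.
Qed.

Lemma sconeP B J x : scone B J x <->
  exists c : 'I_n -> R, (forall j, 0 <= c j) /\ x = \sum_(j in J) c j *: extN R (col j B).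
Proof.
rewrite /scone cone_mapP ?enum_uniq //.
by split=> -[c [c0 ->]]; exists c; rewrite big_enum.
Qed.

Lemma pairing_sum (L : comNzRingType) (u : 'rV[L]_n) (I : Type) (r : seq I) (P : pred I)
    (c : I -> L) (v : I -> 'cV[L]_n) :
  pairing u (\sum_(i <- r | P i) c i *: v i) = \sum_(i <- r | P i) c i * pairing u (v i).
Proof.
rewrite /pairing mulmx_sumr summxE; apply: eq_bigr => i _.
by rewrite -scalemxAr mxE.
Qed.

Section Basis.
Variables (B : 'M[int]_n).
Hypothesis Bu : B \in unitmx.
Local Notation B' := (invmx B).

Lemma invB : B' *m B = 1%:M. Proof. exact: mulVmx. Qed.

Lemma pairing_dual i j : pairing (extM R (row i B')) (extN R (col j B)) = (i == j)%:R.
Proof. by rewrite pairing_ext pairing_col -row_mul invB !mxE; case: eqP. Qed.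

Lemma dual_coord J (c : 'I_n -> R) i :
  pairing (extM R (row i B')) (\sum_(j in J) c j *: extN R (col j B)) =
  if i \in J then c i else 0.
Proof.
rewrite pairing_sum; case: ifPn => iJ.
  rewrite (bigD1 i) //= pairing_dual eqxx mulr1 big1 ?addr0 // => j /andP[_ /negPf ji].
  by rewrite pairing_dual eq_sym ji mulr0.
rewrite big1 // => j jJ; rewrite pairing_dual; case: eqP => [ij|_]; last by rewrite mulr0.
by move: iJ; rewrite ij jJ.
Qed.

Lemma scone_col J j : j \in J -> scone B J (extN R (col j B)).
Proof.
move=> jJ; apply/sconeP; exists (fun i => (i == j)%:R); split=> [i|]; first exact: ler0n.
rewrite (bigD1 j) //= eqxx scale1r big1 ?addr0 // => i /andP[_ /negPf->].
exact: scale0r.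
Qed.

Lemma dual_monoid_scone J m :
  (m \in dual_monoid (scone B J)) = [forall (j | j \in J), 0 <= (m *m B) 0 j].
Proof.
apply/asboolP/forall_inP => [mJ j jJ|mJ x /sconeP[c [c0 ->]]].
  by have := mJ _ (scone_col jJ); rewrite pairing_ext pairing_col ler0z.
rewrite pairing_sum; apply: sumr_ge0 => j jJ; rewrite mulr_ge0 //.
by rewrite pairing_ext pairing_col ler0z mJ.
Qed.

Lemma smooth_scone J : smooth_monoid (dual_monoid (scone B J)) B B' J.
Proof. by split; [exact: invB|exact: dual_monoid_scone]. Qed.

(** A form that is nonnegative on the generators vanishes on a nonnegative combination only if it
    vanishes on every generator that occurs in it. *)
Lemma face_scone J tau : is_face tau (scone B J) ->
  exists2 J' : {set 'I_n}, J' \subset J & tau = scone B J'.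
Proof.
move=> [u [u0 ->]]; pose ub j := pairing u (extN R (col j B)).
exists [set j in J | ub j == 0]%SET; first by apply/fintype.subsetP => j; rewrite inE => /andP[].
have ub0 j : j \in J -> 0 <= ub j by move=> /scone_col/u0.
apply/seteqP; split=> x.
  move=> [/sconeP[c [c0 ->]]]; rewrite /= pairing_sum => /eqP.
  rewrite psumr_eq0 => [/allP cu|j jJ]; last by rewrite mulr_ge0 ?ub0.
  apply/sconeP; exists c; split=> //.
  rewrite (bigID (fun j => ub j == 0)) /= [X in _ + X]big1 ?addr0.
    by apply: eq_bigl => j; rewrite inE.
  move=> j /andP[jJ uj]; have := cu j (mem_index_enum j).
  by rewrite jJ mulf_eq0 (negPf uj) orbF => /eqP->; rewrite scale0r.
move=> /sconeP[c [c0 ->]]; split.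
  apply/sconeP; exists (fun j => if ub j == 0 then c j else 0); split=> [j|].
    by case: ifP.
  rewrite [RHS](bigID (fun j => ub j == 0)) /= [X in _ = _ + X]big1 ?addr0.
    by apply: eq_big => [j|j]; rewrite inE // => /andP[_ ->].
  by move=> j /andP[_ /negPf->]; rewrite scale0r.
rewrite /= pairing_sum big1 // => j; rewrite inE => /andP[_ /eqP uj].
by rewrite -/(ub j) uj mulr0.
Qed.

Lemma pairing_suml (u : 'I_n -> 'rV[R]_n) (P : pred 'I_n) x :
  pairing (\sum_(i | P i) u i) x = \sum_(i | P i) pairing (u i) x.
Proof. by rewrite /pairing mulmx_suml summxE. Qed.

Lemma scone_face (J J' : {set 'I_n}) : J' \subset J -> is_face (scone B J') (scone B J).
Proof.
(* On the cone this form is the sum of the coordinates outside [J'], which is zero only when each of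
   them is. *)
move=> J'J; exists (\sum_(i in (J :\: J')%SET) extM R (row i B')).
have coord (c : 'I_n -> R) : pairing (\sum_(i in (J :\: J')%SET) extM R (row i B'))
    (\sum_(j in J) c j *: extN R (col j B)) = \sum_(i in (J :\: J')%SET) c i.
  rewrite pairing_suml; apply: eq_bigr => i; rewrite inE => /andP[_ iJ].
  by rewrite dual_coord iJ.
split=> [x /sconeP[c [c0 ->]]|]; first by rewrite coord sumr_ge0.
apply/seteqP; split=> x.
  move=> /sconeP[c [c0 ->]].
  have -> : \sum_(j in J') c j *: extN R (col j B) =
      \sum_(j in J) (if j \in J' then c j else 0) *: extN R (col j B).
    rewrite [RHS](bigID (mem J')) /= [X in _ = _ + X]big1 ?addr0.
      apply: eq_big => [j|j ->//]; case jJ': (j \in J'); rewrite ?andbF //.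
      by rewrite (fintype.subsetP J'J).
    by move=> j /andP[_ /negPf->]; rewrite scale0r.
  split.
    by apply/sconeP; eexists; split; last reflexivity; move=> j /=; case: ifP.
  by rewrite /= coord big1 // => j; rewrite inE => /andP[/negPf->].
move=> [/sconeP[c [c0 ->]]]; rewrite /= coord => /eqP.
rewrite psumr_eq0 // => /allP cu; apply/sconeP; exists c; split=> //.
rewrite (bigID (mem J')) /= [X in _ + X]big1 ?addr0.
  apply: eq_bigl => j; case jJ': (j \in J'); rewrite ?andbF ?andbT //.
  by rewrite (fintype.subsetP J'J).
move=> j /andP[jJ jJ']; have := cu j (mem_index_enum j).
by rewrite inE jJ jJ' => /eqP->; rewrite scale0r.
Qed.

Lemma scone0 : scone B finset.set0 = [set 0].
Proof.
apply/seteqP; split=> x; first by move=> /sconeP[c [_ ->]]; rewrite /= big_set0.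
by move=> ->; apply/sconeP; exists (fun=> 0); rewrite big_set0.
Qed.

Lemma scone_dim J : subdim (lspan (scone B J)) = #|J|.
Proof.
apply: (@subdimE _ _ _ _ (fun i : 'I_#|J| => extN R (col (enum_val i) B))).
have reidx (c : 'I_#|J| -> R) : exists c' : 'I_n -> R,
    \sum_i c i *: extN R (col (enum_val i) B) = \sum_(j in J) c' j *: extN R (col j B)
    /\ forall i, c i = c' (enum_val i).
  exists (fun j => \sum_(i | enum_val i == j) c i).
  have cE i : \sum_(l | enum_val l == enum_val i) c l = c i.
    by rewrite (eq_bigl (pred1 i)) ?big_pred1_eq // => l /=; rewrite (inj_eq enum_val_inj).
  split=> //.
  rewrite [RHS](big_enum_val (fun j => (\sum_(i | enum_val i == j) c i) *: extN R (col j B))).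
  by apply: eq_bigr => i _; rewrite cE.
split=> [c c0 i|].
  have [c' [E ->]] := reidx c; move: c0; rewrite E.
  move=> /(congr1 (pairing (extM R (row (enum_val i) B')))).
  by rewrite dual_coord enum_valP /pairing mulmx0 mxE.
apply: lspan_sub => [i|x /sconeP[c [_ ->]]]; first exact/scone_col/enum_valP.
apply/lspan_rangeP; exists (fun i => c (enum_val i)).
by rewrite (big_enum_val (fun j => c j *: extN R (col j B))).
Qed.

Lemma scone_ray_lattice j (w : latN n) :
  scone B (finset.set1 j) (extN R w) <-> exists k : nat, w = col j B *+ k.
Proof.
split=> [/sconeP[c [c0]]|[k ->]]; last first.
  apply/sconeP; exists (fun=> k%:R); split=> [i|]; first exact: ler0n.
  by rewrite big_set1 /extN raddfMn scaler_nat.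
move=> E; have wE i : (pairing (row i B') w)%:~R = (if i == j then c i else 0) :> R.
  by rewrite -pairing_ext E dual_coord inE.
have wj0 : 0 <= pairing (row j B') w by rewrite -(ler0z R) wE eqxx.
exists `|pairing (row j B') w|%N.
rewrite -[LHS]mul1mx -(mulmx1C invB) -mulmxA.
apply/colP => l; rewrite mxE (bigD1 j) //= big1 ?addr0 => [|i ij].
  have -> : (B' *m w) j 0 = pairing (row j B') w by rewrite /pairing -row_mul [RHS]mxE.
  by rewrite mulmxnE mxE -mulr_natr natz gez0_abs.
have /eqP : (pairing (row i B') w)%:~R = 0 :> R by rewrite wE (negPf ij).
rewrite intr_eq0 /pairing -row_mul [X in X == _]mxE => /eqP->; exact: mulr0.
Qed.

(** Two generators of the monoid are natural multiples of each other; pairing with b*_j, which is 1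
    on b_j, gives k l = 1. *)
Lemma prim_gen_ray j : prim_gen (scone B (finset.set1 j)) = col j B.
Proof.
rewrite /prim_gen; case: xgetP => [v _ vP|/(_ (col j B))]; last first.
  by case=> w; exact: scone_ray_lattice.
have /(scone_ray_lattice j)[k Ek] : scone B (finset.set1 j) (extN R v).
  by apply/vP; exists 1%N; rewrite mulr1n.
have /vP[l El] : scone B (finset.set1 j) (extN R (col j B)).
  by apply/scone_ray_lattice; exists 1%N; rewrite mulr1n.
have : pairing (row j B') (col j B) = pairing (row j B') (col j B) *+ (k * l).
  by rewrite {1}El Ek -mulrnA /pairing raddfMn mulmxnE.
rewrite pairing_col -row_mul invB !mxE eqxx => /eqP.
rewrite -mulrnA mul1n eqr_nat eq_sym muln_eq1 => /andP[/eqP k1 _].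
by rewrite Ek k1 mulr1n.
Qed.

End Basis.

End Cones.

(** * Rays and lattice points of the polytope of a smooth complete fan *)

Section Fan.
Variables (R : realType) (n : nat) (Delta : set (set 'cV[R]_n)).
Hypotheses (fD : is_fan Delta) (sD : smooth_fan Delta) (cD : complete_fan Delta).
Implicit Types (v : latN n) (m : latM n).

Lemma dual_monoid0 m : m \in dual_monoid ([set 0] : set 'cV[R]_n).
Proof.
by apply/asboolP => x /= ->; rewrite /pairing mulmx0 mxE.
Qed.

Lemma fan_smooth sigma : Delta sigma ->
  exists (B : 'M[int]_n) (J : {set 'I_n}), B \in unitmx /\ sigma = @scone R n B J.
Proof. exact: sD. Qed.

(** Completeness supplies a cone, and the origin is its face with no generators. *)
Lemma origin_in_fan : Delta [set 0].
Proof.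
have [sigma Ds _] := cD 0; have [B [J [Bu Es]]] := fan_smooth Ds.
apply: (fan_face fD Ds); rewrite Es -(@scone0 R n B).
by apply: scone_face => //; exact: finset.sub0set.
Qed.

Lemma origin_face sigma : Delta sigma -> is_face [set 0] sigma.
Proof.
move=> Ds; have [B [J [Bu ->]]] := fan_smooth Ds.
rewrite -(@scone0 R n B).
by apply: scone_face => //; exact: finset.sub0set.
Qed.

Definition ray_gen v : Prop := exists2 rho, rays Delta rho & prim_gen rho = v.

(** Allows rays to be handled through the bases of the charts: a ray is a smooth cone with one
    generator, and each generator of a cone of the fan spans a face, hence a ray. *)
Lemma ray_genP v : ray_gen v <-> exists (B : 'M[int]_n) (J : {set 'I_n}) j,
  [/\ B \in unitmx, Delta (@scone R n B J), j \in J & v = col j B].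
Proof.
split=> [[rho [Drho dimrho] <-]|[B [J [j [Bu DBJ jJ ->]]]]].
  have [B [J [Bu E]]] := fan_smooth Drho; move: dimrho; rewrite E scone_dim // => /eqP.
  move=> /cards1P[j Ej]; exists B, J, j; split=> //; first by rewrite -E.
    by rewrite Ej finset.set11.
  by rewrite Ej prim_gen_ray.
exists (@scone R n B (finset.set1 j)); last exact: prim_gen_ray.
split; last by rewrite scone_dim // cards1.
by apply: (fan_face fD DBJ); apply: scone_face => //; rewrite finset.sub1set.
Qed.

Lemma anticanonicalP m :
  anticanonical_points Delta m <-> forall v, ray_gen v -> -1 <= pairing m v.
Proof.
have cast v : (-1 <= pairing (extM R m) (extN R v)) = (-1 <= pairing m v).
  by rewrite pairing_ext -[-1 in LHS]/(- (1%:~R)) -rmorphN ler_int.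
split=> [mP v [rho /mP + <-]|mP rho rhoD]; first by rewrite cast.
by rewrite cast; apply: mP; exists rho.
Qed.

(** Any x lies in a cone, where x = sum c_j b_j with c_j >= 0 gives <m, x> >= - sum c_j uniformly in
    m. Taking for x the vectors of the standard basis and their opposites bounds every coordinate of
    m. *)
Lemma anticanonical_finite : finite_set (anticanonical_points Delta).
Proof.
have bound (x : 'cV[R]_n) : exists c : R, forall m, anticanonical_points Delta m ->
    - c <= pairing (extM R m) x.
  have [sigma Ds sx] := cD x; have [B [J [Bu Es]]] := fan_smooth Ds.
  move: sx; rewrite Es => /sconeP[c [c0 ->]].
  exists (\sum_(j in J) c j) => m /anticanonicalP mP.
  rewrite pairing_sum -sumrN; apply: ler_sum => j jJ.
  rewrite -mulrN1; apply: ler_wpM2l => //.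
  rewrite pairing_ext -[-1]/(- (1%:~R)) -rmorphN ler_int; apply: mP.
  by apply/ray_genP; exists B, J, j; split=> //; rewrite -Es.
have pairE m l : pairing (extM R m) (delta_mx l 0) = (m 0 l)%:~R.
  by rewrite /pairing -colE !mxE.
have pairN m l : pairing (extM R m) (- delta_mx l 0) = - (m 0 l)%:~R.
  by rewrite /pairing mulmxN mxE -[X in - X]/(pairing _ _) pairE.
have /choice[N NP] (l : 'I_n) : exists N : nat, forall m,
    anticanonical_points Delta m -> (absz (m ord0 l) <= N)%N.
  have [c cP] := bound (delta_mx l 0); have [c' cP'] := bound (- delta_mx l 0).
  exists (Num.bound (`|c| + `|c'|)) => m mP.
  have := cP m mP; have := cP' m mP; rewrite pairE pairN => h1 h2.
  have h3 : `|(m 0 l)%:~R : R| <= `|c| + `|c'|.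
    rewrite ler_norml; apply/andP; split.
      apply: le_trans h2; rewrite lerN2; apply: le_trans (ler_norm c) _.
      by rewrite lerDl.
    rewrite -[X in X <= _]opprK lerNl; apply: le_trans h1; rewrite lerN2.
    by apply: le_trans (ler_norm c') _; rewrite lerDr.
  have h4 := archi_boundP (le_trans (normr_ge0 _) h3).
  have := le_lt_trans h3 h4; rewrite -intr_norm -[X in _ < X]/((Posz _)%:~R) ltr_int.
  by move=> /ltW; rewrite -abszE lez_nat.
(* The integers of absolute value at most max N, shifted by max N, are the naturals up to 2 max
   N. *)
pose T := {ffun 'I_n -> 'I_(\max_l N l).*2.+1}.
pose f (g : T) : latM n := \row_l ((g l)%:Z - (\max_l N l)%:Z).
apply: (@sub_finite_set _ _ (range f)); last exact/finite_image/finite_finset.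
move=> m mP; exists [ffun l => inord (absz (m 0 l + (\max_l N l)%:Z))] => //.
apply/rowP => l; rewrite !mxE ffunE.
have ml : (absz (m ord0 l) <= \max_l N l)%N.
  by apply: leq_trans (NP l m mP) _; exact: (leq_bigmax l).
have m0 : 0 <= m 0 l + (\max_l N l)%:Z.
  rewrite -lerBlDr sub0r lerNl; apply: le_trans (ler_norm _) _.
  by rewrite normrN -abszE lez_nat.
rewrite inordK; first by rewrite gez0_abs // addrK.
rewrite ltnS -lez_nat gez0_abs // -addnn PoszD lerD2r.
by apply: le_trans (ler_norm _) _; rewrite -abszE lez_nat.
Qed.

End Fan.

(** * Polyvector fields regular along the divisors *)

Lemma sum_shifted_binomial (L : comNzRingType) (x : L) n i : (i <= n)%N ->
  \sum_(k < n.+1) (if (i <= k)%N then 'C(n - i, k - i) else 0%N)%:R * x ^+ k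
    = x ^+ i * (1 + x) ^+ (n - i).
Proof.
move=> le_in.
rewrite -(big_mkord xpredT (fun k => (if (i <= k)%N then 'C(n - i, k - i) else 0%N)%:R * x ^+ k)).
rewrite (@big_cat_nat _ _ _ i) //=; last exact: leqW.
rewrite big_nat big1 ?add0r; last first.
  by move=> j /andP[_ ji]; rewrite leqNgt ji mul0r.
rewrite -[X in \sum_(X <= _ < _) _]add0n big_addn subSn // big_mkord exprDn mulr_sumr.
apply: eq_bigr => j _; rewrite leq_addl addnK expr1n mul1r exprD mulrC.
by rewrite -[in RHS]mulr_natr mulrA [x ^+ j * _]mulrC.
Qed.

Lemma sum_poly_binomial n (X : {fset latM n}) (d : latM n -> nat) :
  (forall m, (d m <= n)%N) ->
  \sum_(k < n.+1) 'X^k * (\sum_(m <- X)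
      (if (d m <= k)%N then 'C(n - d m, k - d m) else 0%N)%:Z *: gexp (- m))%:P =
  \sum_(m <- X) (gexp (- m) : grpalg int (latM n))%:P * 'X^(d m) * (1 + 'X) ^+ (n - d m).
Proof.
have swap (L : comNzRingType) (g y : L) c : y * (g *+ c) = g * (c%:R * y).
  by rewrite -[g *+ c]mulr_natr; ring.
move=> dn; under eq_bigr do rewrite rmorph_sum mulr_sumr.
rewrite exchange_big; apply: eq_bigr => m _ /=.
rewrite -mulrA -sum_shifted_binomial // mulr_sumr; apply: eq_bigr => k _.
rewrite -natz scaler_nat rmorphMn /=; exact: swap.
Qed.

Section WeightSpaces.
Variables (K : fieldType) (n k : nat) (kn : (k <= n)%N) (S0 : addrClosed (latM n)).
Hypothesis S0T : forall m, m \in S0.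
(* G is the set of ray generators and X the set of lattice points of the polytope. *)
Variables (G : set (latN n)) (X : {fset latM n}).
Hypothesis G0 : forall v, G v -> extN K v != 0.
Hypothesis XP : forall m, m \in X <-> forall v, G v -> -1 <= pairing m v.
Local Notation T0 := (extpow (der (monalg K S0)) k).
Local Notation enumI := (enumI kn).
Implicit Types (m : latM n).

(* Regularity along the toric divisors, one weight m at a time: the component
   of weight m is divisible by every v with <m, v> = -1, and vanishes if some
   <m, v> < -1. *)
Definition regular (z : T0) : Prop := forall xi m v,
  plm xi m z != 0 -> G v ->
  -1 <= pairing m v /\
  (pairing m v = -1 -> exists i, pairing (row i xi) (extN K v) != 0).

Definition gens m : set 'cV[K]_n := [set extN K v | v in [set v | G v /\ pairing m v = -1]].
Definition dimL m : nat := subdim (lspan (gens m)).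

(* A basis of K^n, with its dual, whose first dimL m vectors are ray generators
   spanning L_m. *)
Let adapted m : exists CC : 'M[K]_n * 'M[K]_n, [/\ (dimL m <= n)%N,
    CC.2 *m CC.1 = 1%:M,
    forall j : 'I_n, (j < dimL m)%N -> gens m (col j CC.1) &
    forall v, gens m v -> exists a : 'I_n -> K,
      v = \sum_(j < n | (j < dimL m)%N) a j *: col j CC.1].
Proof.
have [i [C [C' [h1 h2 h3 h4 h5]]]] := adapted_basis (gens m).
by exists (C, C'); rewrite /dimL h5.
Qed.

Let C m : 'M[K]_n := (sval (cid (adapted m))).1.
Let C' m : 'M[K]_n := (sval (cid (adapted m))).2.

Let CP m : [/\ (dimL m <= n)%N, C' m *m C m = 1%:M,
    forall j : 'I_n, (j < dimL m)%N -> gens m (col j (C m)) &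
    forall v, gens m v -> exists a : 'I_n -> K,
      v = \sum_(j < n | (j < dimL m)%N) a j *: col j (C m)].
Proof. by rewrite /C /C'; case: cid. Qed.

Let C'C m : C' m *m C m = 1%:M. Proof. by have [] := CP m. Qed.

Lemma dimL_le m : (dimL m <= n)%N. Proof. by have [] := CP m. Qed.

Definition contains_L m (I : {set 'I_n}) : bool :=
  (#|I| == k) && [forall j : 'I_n, (j < dimL m)%N ==> (j \in I)].

(** A generator v with <m, v> = -1 lies in L_m, hence in the span of the columns indexed by [I], and
    [det_vanish] applies. *)
Lemma xdv_regular m I : m \in X -> contains_L m I -> regular (xdv kn S0T m (C m) I).
Proof.
move=> /XP mD /andP[/eqP cI /forall_inP LI] xi m' v.
rewrite plm_xdv; case: (eqVneq m' m) => [->|_]; last by rewrite mul0r eqxx.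
rewrite mul1r => dI gv; split=> [|mv]; first exact: mD.
have [_ _ _ gensE] := CP m.
have [a Ea] : exists a : 'I_n -> K, extN K v = \sum_(j < n | (j < dimL m)%N) a j *: col j (C m).
  by apply: gensE; exists v.
apply: (det_vanish (C := C m) (I := I) (a := fun j => if (j < dimL m)%N then a j else 0) cI _ _ dI).
  exact: G0.
rewrite Ea [RHS](bigID (fun j : 'I_n => (j < dimL m)%N)) /= [X in _ = _ + X]big1 ?addr0.
  apply: eq_big => [j|j ->//]; case: (ltnP j (dimL m)) => // jL; rewrite ?andbF // andbT.
  by rewrite LI.
by move=> j /andP[_ /negPf->]; rewrite scale0r.
Qed.

(** Regularity is tested on the rows of [C' m] indexed by [I]: for j < [dimL m] the j-th column is a
    ray generator pairing to -1 with m, and these rows all kill it unless j is in [I]. *)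
Lemma regular_support z m (I : {set 'I_n}) : regular z -> #|I| = k ->
  plm (rowsub (enumI I) (C' m)) m z != 0 -> m \in X /\ contains_L m I.
Proof.
move=> zreg cI z0; split.
  by apply/XP => v gv; have [] := zreg _ _ _ z0 gv.
rewrite /contains_L cI eqxx; apply/forall_inP => j jL.
have [_ _ /(_ j jL)[v [gv mv] Ev] _] := CP m.
case: (zreg _ _ _ z0 gv) => _ h; case: (h mv) => i.
rewrite Ev row_rowsub.
have -> : pairing (row (enumI I i) (C' m)) (col j (C m)) = (enumI I i == j)%:R.
  by rewrite pairing_col -row_mul C'C !mxE; case: eqP.
by case: (eqVneq (enumI I i) j) => [<- _|_]; rewrite ?enumI_in ?eqxx.
Qed.

Definition index := {p : X * {set 'I_n} | contains_L (val p.1) p.2}.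
HB.instance Definition _ := Finite.on index.

Lemma index_sum (V : nmodType) (f : X -> {set 'I_n} -> V) :
  \sum_(p : index) f (val p).1 (val p).2 = \sum_(x : X) \sum_(I | contains_L (val x) I) f x I.
Proof.
rewrite pair_big_dep /=.
rewrite [RHS](reindex_omap (val : index -> X * {set 'I_n}) insub) /=; last first.
  by move=> q qP; rewrite insubT.
by apply: eq_bigl => p; rewrite valK eqxx (valP p).
Qed.

Definition basis_vec (p : index) : T0 :=
  xdv kn S0T (val (val p).1) (C (val (val p).1)) (val p).2.

Lemma basis_vec_dual (p q : index) :
  (val (val p).1 == val (val q).1)%:R * \det (rowsub (enumI (val p).2) (C' (val (val p).1)) *m
    colsub (enumI (val q).2) (C (val (val q).1))) = (q == p)%:R :> K.
Proof.
have [pq|] := eqVneq (val (val p).1) (val (val q).1); last first.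
  rewrite mul0r; case: (eqVneq q p) => [->|//]; by rewrite eqxx.
have /andP[/eqP cp _] := valP p; have /andP[/eqP cq _] := valP q.
rewrite mul1r -pq (det_dual kn (C'C _)) //; congr (_ %:R); congr nat_of_bool.
apply/eqP/eqP => [Ipq|->//]; apply/val_inj/esym.
rewrite [val p]surjective_pairing [val q]surjective_pairing Ipq; congr pair.
exact: val_inj.
Qed.

(** Compared weight by weight: in the adapted basis of weight m, [regular_support] discards every m
    outside [X] and every subset missing an index of the basis of L_m. *)
Lemma regular_expand z : regular z ->
  z = \sum_(p : index)
    (plm (rowsub (enumI (val p).2) (C' (val (val p).1))) (val (val p).1) z)%:A *: basis_vec p.
Proof.
move=> zreg; apply: (plm_eq kn S0T) => xi m.
rewrite [RHS]plm_sum_xdv.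
rewrite (index_sum (fun x I => plm (rowsub (enumI I) (C' (val x))) (val x) z *
   ((m == val x)%:R * \det (xi *m colsub (enumI I) (C (val x)))))).
rewrite (plm_expand kn S0T _ _ _ (C'C m)).
have [mX|nX] := boolP (m \in X); last first.
  rewrite !big1 // => [x _|I /eqP cI].
    rewrite big1 // => I _; case: eqP => [mx|_]; last by rewrite mul0r mulr0.
    by move: nX; rewrite mx (valP x).
  case: (eqVneq (plm (rowsub (enumI I) (C' m)) m z) 0) => [->|]; first by rewrite mul0r.
  by case/(regular_support zreg cI); rewrite (negPf nX).
rewrite [RHS](bigD1 [` mX]%fset) //= [X in _ = _ + X]big1 ?addr0; last first.
  move=> x xm; rewrite big1 // => I _; case: eqP => [mx|_]; last by rewrite mul0r mulr0.
  by case/eqP: xm; exact: val_inj.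
rewrite [LHS](bigID (contains_L m)) /= [X in _ + X]big1 ?addr0; last first.
  move=> I /andP[/eqP cI nI].
  case: (eqVneq (plm (rowsub (enumI I) (C' m)) m z) 0) => [->|]; first by rewrite mul0r.
  by case/(regular_support zreg cI) => _; rewrite (negPf nI).
apply: eq_big => [I|I _]; first by rewrite /contains_L andbA andbb.
by rewrite eqxx mul1r.
Qed.

Lemma basis_vec_regular p : regular (basis_vec p).
Proof. by apply: xdv_regular; [exact: valP|exact: (valP p)]. Qed.

Lemma basis_vec_free (c : index -> K) :
  \sum_p (c p)%:A *: basis_vec p = 0 -> forall p, c p = 0.
Proof. exact: xdv_free basis_vec_dual. Qed.

Definition index_weight (p : index) : latM n := - val (val p).1.

Lemma act_basis_vec t p :
  ext_act t (basis_vec p) = (chi (index_weight p) t)%:A *: basis_vec p.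
Proof. exact: ext_act_xdv. Qed.

Lemma card_index_weight m : #|[set p : index | index_weight p == - m]%SET| =
  if m \in X then if (dimL m <= k)%N then 'C(n - dimL m, k - dimL m) else 0%N else 0%N.
Proof.
rewrite -sum1_card (eq_bigl (fun p : index => val (val p).1 == m)); last first.
  by move=> p; rewrite inE /index_weight eqr_opp.
rewrite big_mkcond (index_sum (fun x I => if val x == m then 1%N else 0%N)) /=.
case: ifPn => [mX|nX]; last first.
  rewrite big1 // => x _; rewrite big1 // => I _; case: eqP => // xm.
  by move: nX; rewrite -xm (valP x).
rewrite (bigD1 [` mX]%fset) //= [X in _ + X]big1 ?addr0; last first.
  move=> x xm; rewrite big1 // => I _; case: eqP => [mx|//].
  by case/eqP: xm; exact: val_inj.
rewrite -(card_supersets _ (dimL_le m)) eqxx -sum1_card; apply: eq_bigl => I.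
by rewrite inE.
Qed.

End WeightSpaces.

(** * Global sections *)

Section GlobalSections.
Variables (R : realType) (n : nat) (Delta : set (set 'cV[R]_n)).
Hypotheses (fD : is_fan Delta) (sD : smooth_fan Delta) (cD : complete_fan Delta).
Variables (k : nat) (kn : (k <= n)%N).
Variable (o : Delta).
Hypothesis oE : set_val o = [set 0].

Let F : fieldType := R[i].
Local Notation S a := (dual_monoid (set_val a)).
Local Notation res := (@ext_restr F n k _ (S o)).
Local Notation enumI := (enumI kn).
Implicit Types (s : local_families Delta k) (a b : Delta) (m : latM n).

Let S0T m : m \in S o. Proof. by rewrite oE dual_monoid0. Qed.

Let chart_smooth a : exists (B : 'M[int]_n) (J : {set 'I_n}),
  [/\ B \in unitmx, set_val a = scone B J & smooth_monoid (S a) B (invmx B) J].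
Proof.
have [B [J [Bu Ea]]] := fan_smooth sD (set_mem (valP a)).
by exists B, J; split=> //; rewrite [set_val a]Ea; exact: smooth_scone.
Qed.

Let res_eq a (v w : extpow (der (monalg F (S a))) k) : res v = res w -> v = w.
Proof.
have [B [J [Bu Ea smA]]] := chart_smooth a => vw.
exact: (ext_restr_injective kn S0T smA vw).
Qed.

(* A retyping of s a over the fieldType F, so that the lemmas above unify with
   it without comparing two ring structures on R[i] at each step. *)
Definition sec s a : extpow (der (monalg F (S a))) k := s a.

Let face_o a : is_face (set_val o) (set_val a).
Proof. by rewrite oE; apply: (origin_face sD); exact: set_mem (valP a). Qed.

(** The torus is a face of every cone. Conversely, agreement on the torus gives agreement on each
    face, as restrictions compose and restriction from the face to the torus is injective. *)
Lemma H0P s : H0 Delta k s <-> forall a, res (sec s a) = sec s o.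
Proof.
split=> [sH a|sH a b ba]; first exact: (sH a o (face_o a)).
rewrite -[RHS]/(sec s b) -[LHS]/(ext_restr (S b) (sec s a)).
have [B [J [Bu Ea smA]]] := chart_smooth a.
(* The face is generated by part of the same lattice basis, so both charts are described with the
   same [B]. *)
have [J' J'J Eb] : exists2 J' : {set 'I_n}, J' \subset J & set_val b = scone B J'.
  by apply: face_scone => //; rewrite -Ea.
have smB : smooth_monoid (S b) B (invmx B) J' by rewrite [set_val b]Eb; exact: smooth_scone.
have SS : {subset S a <= S b}.
  move=> m; rewrite smA.2 smB.2 => /forall_inP mJ; apply/forall_inP => j jJ'.
  by apply: mJ; exact: (fintype.subsetP J'J).
have E := ext_restr_comp (K := F) SS smA smB S0T (sec s a).
apply: res_eq; apply: (etrans E); apply: (etrans (sH a)); exact: esym (sH b).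
Qed.

Lemma glue (z : extpow (der (monalg F (S o))) k) :
  (forall a, exists w : extpow (der (monalg F (S a))) k, res w = z) ->
  exists s, H0 Delta k s /\ sec s o = z.
Proof.
move=> zw; pose s : local_families Delta k := fun a => sval (cid (zw a)).
have sE a : res (sec s a) = z by rewrite /sec /s; case: cid.
have so : sec s o = z.
  (* Restriction from the cone 0 to itself is not the identity by definition; being injective and
     idempotent, it is. *)
  rewrite -(sE o); apply: res_eq.
  have [B [J [Bu Ea smA]]] := chart_smooth o.
  exact/esym/(ext_restr_comp (K := F) (k := k) _ smA smA S0T).
by exists s; split=> //; apply/H0P => a; rewrite sE so.
Qed.

Lemma sec_eq s s' : (forall a, sec s a = sec s' a) -> s = s'.
Proof. by move=> ss'; apply: functional_extensionality_dep => a; exact: ss'. Qed.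

Lemma secD s s' a : sec (s + s') a = sec s a + sec s' a. Proof. by []. Qed.

Lemma secZ (c : F) s a : sec (c *: s) a = c%:A *: sec s a. Proof. by []. Qed.

Lemma sec0 a : sec (0 : local_families Delta k) a = 0. Proof. by []. Qed.

Lemma sec_sum (I : finType) (c : I -> F) (G : I -> local_families Delta k) a :
  sec (\sum_i c i *: G i) a = \sum_i (c i)%:A *: sec (G i) a.
Proof.
rewrite (big_morph (fun s => sec s a) (fun s s' => secD s s' a) (sec0 a)).
by apply: eq_bigr => i _; rewrite secZ.
Qed.

Let pairing_rowsub I (B' B : 'M[int]_n) i j : B' *m B = 1%:M ->
  pairing (row i (rowsub (enumI I) (map_mx intr B' : 'M[F]_n))) (extN F (col j B)) =
  (enumI I i == j)%:R.
Proof.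
move=> BB; rewrite row_rowsub -map_row -[map_mx _ _]/(extM F _) pairing_ext pairing_col.
by rewrite -row_mul BB !mxE; case: eqP.
Qed.

Lemma ray_gen_neq0 v : ray_gen Delta v -> extN F v != 0.
Proof.
move=> /(ray_genP fD sD)[B [J [j [Bu _ _ ->]]]].
apply/eqP => /(congr1 (pairing (extM F (row j (invmx B))))).
rewrite pairing_ext pairing_col -row_mul invB // !mxE eqxx.
by rewrite /pairing mulmx0 mxE => /eqP; rewrite oner_eq0.
Qed.

(** From charts to [regular]: a nonzero value on [xi] comes from some I with nonzero coordinate and
    nonzero minor in the chart basis, and j in I yields the nonvanishing by [det_vanish].
    Conversely, the dual rows indexed by I all kill b_j unless j is in I. *)
Lemma regularP z :
  (forall a, exists w : extpow (der (monalg F (S a))) k, res w = z) <->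
  regular (ray_gen Delta) z.
Proof.
split=> [zw xi m v z0 gv|zreg a].
  have [B [J [j [Bu DBJ jJ Ev]]]] := (ray_genP fD sD v).1 gv.
  pose a : Delta := exist _ (scone B J) (mem_set DBJ).
  have smA : smooth_monoid (S a) B (invmx B) J by exact: smooth_scone.
  have /(ext_restr_image kn S0T smA) zP := zw a.
  have C'C := dual_basis_map F smA.
  have [I [cI zI dI]] := plm_expand_neq0 kn S0T C'C z0.
  have := zP I cI m zI j jJ; rewrite Ev pairing_col => pm; split.
    rewrite -(lerD2r (j \in I)%:R); apply: le_trans pm.
    by case: (j \in I).
  move=> mj; move: pm; rewrite mj; case: (boolP (j \in I)) => // jI _.
  apply: (det_vanish (v := extN F (col j B)) (a := fun i => (i == j)%:R) cI _ _ dI).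
    by rewrite -Ev ray_gen_neq0.
  rewrite (bigD1 j) //= eqxx scale1r big1 ?addr0; first by rewrite /extN map_col.
  by move=> i /andP[_ /negPf->]; rewrite scale0r.
have [B [J [Bu Ea smA]]] := chart_smooth a.
apply/(ext_restr_image kn S0T smA) => I cI m z0 j jJ.
have gj : ray_gen Delta (col j B).
  by apply/(ray_genP fD sD); exists B, J, j; split=> //; rewrite -Ea; exact: set_mem (valP a).
have [pm mj] := zreg _ _ _ z0 gj; move: pm mj; rewrite pairing_col => pm mj.
case: (boolP (j \in I)) => [|jI]; first by rewrite -lerBlDr sub0r.
rewrite addr0; have [mj1|] := eqVneq ((m *m B) 0 j) (-1); last first.
  by move: pm; case: (_ 0 j) => [//|[|c]].
case: (mj mj1) => i; rewrite pairing_rowsub; last exact: smA.1.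
case: (eqVneq (enumI I i) j) => [ij _|_]; last by rewrite eqxx.
by move: jI; rewrite -ij enumI_in.
Qed.

Local Notation D := (anticanonical_points Delta).
Let X := fset_set D.

Let XE m : (m \in X) = `[< D m >].
Proof.
rewrite in_fset_set; last exact: anticanonical_finite.
by apply/idP/asboolP; rewrite inE.
Qed.

Let XP m : m \in X <-> forall v, ray_gen Delta v -> -1 <= pairing m v.
Proof. by rewrite XE; split=> [/asboolP/anticanonicalP|/anticanonicalP/asboolP]. Qed.

Local Notation idx := (index F k (ray_gen Delta) X).
Let vec (p : idx) : extpow (der (monalg F (S o))) k := basis_vec kn S0T p.

Let basis_ex (p : idx) : exists s, H0 Delta k s /\ sec s o = vec p.
Proof. apply: glue; apply/regularP; exact: (basis_vec_regular ray_gen_neq0 XP). Qed.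

Definition basis_sec (p : idx) : local_families Delta k := sval (cid (basis_ex p)).

Lemma basis_sec_H0 p : H0 Delta k (basis_sec p).
Proof. by rewrite /basis_sec; case: cid => s []. Qed.

Lemma basis_secE p : sec (basis_sec p) o = vec p.
Proof. by rewrite /basis_sec; case: cid => s []. Qed.

Lemma basis_res p a : res (sec (basis_sec p) a) = vec p.
Proof. exact: etrans ((H0P _).1 (basis_sec_H0 p) a) (basis_secE p). Qed.

Let sec_comb (c : idx -> F) : sec (\sum_p c p *: basis_sec p) o = \sum_p (c p)%:A *: vec p.
Proof. by rewrite sec_sum; apply: eq_bigr => p _; rewrite basis_secE. Qed.

Let res_comb (c : idx -> F) a :
  res (sec (\sum_p c p *: basis_sec p) a) = \sum_p (c p)%:A *: vec p.
Proof.
have [B [J [Bu Ea smA]]] := chart_smooth a.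
rewrite sec_sum; apply: etrans (ext_restr_lin S0T smA _ _) _.
by apply: eq_bigr => p _; rewrite basis_res.
Qed.

(** Independence is seen on the torus chart; spanning is the expansion of a regular field, lifted
    chart by chart through the injectivity of restriction. *)
Lemma H0_basis : fin_basis (H0 Delta k) basis_sec.
Proof.
split=> [c c0 p|s].
  apply: (basis_vec_free (kn := kn) (S0T := S0T) (c := c)).
  by apply: (etrans (esym (sec_comb c))); rewrite c0 sec0.
split=> [/H0P sH|[c ->]]; last first.
  by apply/H0P => a; exact: etrans (res_comb c a) (esym (sec_comb c)).
have zreg : regular (ray_gen Delta) (sec s o).
  by apply/regularP => a; exists (sec s a); exact: sH.
have E := regular_expand kn S0T XP zreg.
eexists; apply: sec_eq => a; apply: res_eq.
apply: etrans (sH a) _; apply: etrans E _; exact: esym (res_comb _ a).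
Qed.

Local Notation act := (torus_act Delta k).

Lemma sec_act t s a : sec (act t s) a = ext_act t (sec s a). Proof. by []. Qed.

Lemma actD t s s' : act t (s + s') = act t s + act t s'.
Proof. by apply: sec_eq => a; rewrite secD !sec_act secD ext_actD. Qed.

Lemma actZ t (c : F) s : act t (c *: s) = c *: act t s.
Proof. by apply: sec_eq => a; rewrite secZ !sec_act secZ ext_actZ tpull_scalar. Qed.

Lemma act_basis t p : act t (basis_sec p) = chi (index_weight p) t *: basis_sec p.
Proof.
apply: sec_eq => a; have [B [J [Bu Ea smA]]] := chart_smooth a.
have SS : {subset S a <= S o} by move=> m _; exact: S0T.
apply: res_eq; rewrite sec_act secZ.
apply: etrans (ext_act_restr SS smA (smooth_all S0T smA.1) t _) _.
apply: etrans (congr1 _ (basis_res p a)) _.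
apply: etrans (act_basis_vec kn S0T t p) _.
apply: esym; apply: etrans (ext_restrZ S0T smA _ _) _.
rewrite (inclZ SS) (incl1 _ SS); congr (_ *: _); exact: basis_res.
Qed.

Lemma H0_rep : fd_rational_rep act (H0 Delta k).
Proof. exact: (weight_basis_rep actD actZ H0_basis act_basis). Qed.

Lemma H0_weight m : subdim (weight_space act (H0 Delta k) (- m)) =
  if `[< D m >] then if (span_dim Delta (extM R m) <= k)%N then
    'C(n - span_dim Delta (extM R m), k - span_dim Delta (extM R m)) else 0%N else 0%N.
Proof.
apply: etrans (weight_basis_dim actD actZ H0_basis act_basis (- m)) _.
apply: etrans (card_index_weight _ _ _ _ m) _; rewrite XE.
(* [span_at] selects rays by a real pairing and [gens] by an integral one; both select the same
   generators. *)
suff -> : span_dim Delta (extM R m) = dimL F (ray_gen Delta) m by [].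
rewrite /span_dim /dimL; congr (subdim (lspan _)).
apply/seteqP; split=> [w [rho [Drho mrho] <-]|w [v [[rho Drho <-] mv] <-]].
  exists (prim_gen rho) => //; split; first by exists rho.
  apply: (@intr_inj R); rewrite -pairing_ext mrho.
  by rewrite -[-1 in RHS]/(- (1%:~R)) rmorphN.
exists rho => //; split=> //.
by rewrite pairing_ext mv -[-1 in RHS]/(- (1%:~R)) rmorphN.
Qed.

End GlobalSections.

(** A sum with infinite support takes a default value; the first two clauses ensure that both sides
    of the identity are the intended sums. *)
Theorem proposition4p2 (R : realType) (n : nat) (Delta : set (set 'cV[R]_n)) :
  is_fan Delta -> smooth_fan Delta -> complete_fan Delta ->
  [/\ forall k : nat, (k <= n)%N ->
        fd_rational_rep (torus_act Delta k) (H0 Delta k),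
      finite_set (anticanonical_points Delta)
    & \sum_(k < n.+1)
        'X^k * (formal_char (torus_act Delta k) (H0 Delta k))%:P
      = \sum_(m \in anticanonical_points Delta)
          (gexp (- m) : grpalg int (latM n))%:P * 'X^(span_dim Delta (extM R m)) *
          (1 + 'X) ^+ (n - span_dim Delta (extM R m))
      :> {poly grpalg int (latM n)}].
Proof.
move=> fD sD cD.
have Pfin := anticanonical_finite fD sD cD.
pose o : Delta := exist _ [set 0] (mem_set (origin_in_fan fD sD cD)).
have oE : set_val o = [set 0] by [].
pose d m := span_dim Delta (extM R m).
have dn m : (d m <= n)%N.
  have [i [_ [_ [le_in _ _ _ E]]]] := adapted_basis [set extN R[i] (prim_gen rho) |
    rho in [set rho | rays Delta rho /\ pairing (extM R m) (extN R (prim_gen rho)) = -1]].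
  by rewrite /d /span_dim E.
split=> [k kn||]; [exact: (H0_rep fD sD cD kn oE)|exact: Pfin|].
rewrite fsbig_finite //= -(sum_poly_binomial _ dn); apply: eq_bigr => k _.
congr ('X^k * _%:P); apply: formal_charE => m.
have kn : (k <= n)%N by rewrite -ltnS.
rewrite (H0_weight fD sD cD kn oE) in_fset_set //.
Qed.
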